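(* Let $p(x)=\sum_{i\ge0}x^i$, define $M_{\mu^p}(z)=M_{\mu^c}\big(z/\sqrt{p(1/c)}\big)$, expanded as a formal power series in $1/c$, and let $\hat V_i(z)=[c^{-i}]\,M_{\mu^p}(\sqrt z)$. Then for $i=0,1,2$, $\hat V_i(z)$ is $C(z)$ times a polynomial in $zC(z)^2$, and for every $i\ge3$ there exists a polynomial $\hat Q_i(x)$ such that \[ \hat V_i(z)=C(z)\,\frac{\hat Q_i\big(zC(z)^2\big)}{\big(1-zC(z)^2\big)^{2i-3}}. \]
   Context: A tree walk of size $m$ and length $L$ is a sequence $(v_1,\dots,v_L)$ of elements of $[m]$ in which every element of $[m]$ occurs, such that the graph with vertex set $[m]$ and edges $\{v_j,v_{j+1}\}$ ($1\le j<L$) and $\{v_L,v_1\}$ is a tree. $w_{m,2\ell}$ is the number of tree walks of size $m$ and length $2\ell$ (with $w_{1,0}=1$, $w_{1,2\ell}=0$ for $\ell\ge1$, $w_{0,2\ell}=0$). $W_\xi(z)=\sum_{\ell\ge0}\frac{w_{\ell-\xi+1,2\ell}}{(\ell-\xi+1)!}z^\ell$. $M_{\mu^c}(z)=\sum_{\ell\ge0}m_{2\ell}(\mu^c)z^{2\ell}$ is the ordinary moment generating function of the limiting spectral measure $\mu^c$ of $c^{-1/2}A(G(n,c/n))$, whose even moments are $m_{2\ell}(\mu^c)=\sum_{m=1}^{\ell+1}c^{-(\ell-m+1)}\frac{w_{m,2\ell}}{m!}$; equivalently $M_{\mu^c}(z)=\sum_{\xi\ge0}c^{-\xi}W_\xi(z^2)$.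 $C(z)=\frac{1-\sqrt{1-4z}}{2z}$ is the Catalan generating function. *)

(* Defs.v *)
From HB Require Import structures.
From mathcomp Require Import all_boot all_order all_algebra.
Set Implicit Arguments. Unset Strict Implicit. Unset Printing Implicit Defensive.
Import Order.TTheory GRing.Theory Num.Theory.

Definition walk_adj (m L : nat) (v : {ffun 'I_L -> 'I_m}) : rel 'I_m :=
  fun x y => (x != y) &&
    [exists j : 'I_L, ((v j == x) && (v (ordS j) == y))
                   || ((v j == y) && (v (ordS j) == x))].

(* A tree: nonempty, connected, and acyclic (no cycle x_1 ~ ... ~ x_k ~ x_1
   of k >= 3 distinct vertices; such a cycle has k <= m). *)
Definition is_tree (m : nat) (e : rel 'I_m) : bool :=
  (0 < m)%N &&
  [forall x, forall y, connect e x y] &&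
  [forall k : 'I_m.+1, forall c : k.-tuple 'I_m,
      (3 <= k)%N ==> ~~ (cycle e c && uniq c)].

(* Tree walk of size m and length L: every vertex occurs, no consecutive
   (cyclically) repeated vertex (a loop edge would not give a tree), and
   the graph of traversed edges is a tree. *)
Definition is_tree_walk (m L : nat) (v : {ffun 'I_L -> 'I_m}) : bool :=
  [forall x : 'I_m, x \in codom v] &&
  [forall j : 'I_L, v j != v (ordS j)] &&
  is_tree (walk_adj v).

Definition w (m l : nat) : nat :=
  if m == 0%N then 0%N
  else if m == 1%N then (l == 0%N : nat)
  else #|[set v : {ffun 'I_(2 * l) -> 'I_m} | is_tree_walk v]|.

Local Open Scope ring_scope.

Definition ps := nat -> rat.
Definition ps1 : ps := fun n => (n == 0%N)%:R.
Definition psX : ps := fun n => (n == 1%N)%:R.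
Definition psmul (f g : ps) : ps := fun n => \sum_(k < n.+1) f k * g (n - k)%N.
Definition psexp (f : ps) (k : nat) : ps := iter k (psmul f) ps1.
Definition pssub (f g : ps) : ps := fun n => f n - g n.
Definition pscomp (Q : {poly rat}) (f : ps) : ps :=
  fun n => \sum_(k < size Q) Q`_k * psexp f k n.

(* Catalan generating function C(z) = (1 - sqrt(1-4z))/(2z), as its power
   series: [z^n] C(z) = binom(2n,n)/(n+1). *)
Definition Cps : ps := fun n => ('C(n.*2, n))%:R / (n.+1)%:R.
Definition zC2 : ps := psmul psX (psmul Cps Cps).

(* [z^l] W_xi(z) = w_{l-xi+1,2l} / (l-xi+1)!  (zero when l - xi + 1 < 0). *)
Definition wcoef (xi l : nat) : rat :=
  if (xi <= l.+1)%N then (w (l.+1 - xi) l)%:R / ((l.+1 - xi)`!)%:R else 0.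

(* M_{mu^c}(sqrt t) = sum_xi u^xi W_xi(t), u = 1/c.  Since p(u) = 1/(1-u),
   M_{mu^p}(sqrt t) = M_{mu^c}(sqrt (t (1-u))) = sum_xi u^xi W_xi(t (1-u)),
   so [u^i t^l] M_{mu^p}(sqrt t)
     = sum_{xi <= i} [t^l]W_xi * [u^(i-xi)] (1-u)^l. *)
Definition Vhat (i : nat) : ps := fun l =>
  \sum_(xi < i.+1) wcoef xi l * ((-1) ^+ (i - xi) * ('C(l, i - xi))%:R).

(* Main.v *)
Require Import Defs.
From HB Require Import structures.
From mathcomp Require Import all_boot all_order all_algebra.
From mathcomp Require Import boolp ring zify.
Import GRing.Theory Num.Theory.
Set Implicit Arguments. Unset Strict Implicit. Unset Printing Implicit Defensive.

(* Weight a closed walk covering a tree with m vertices by z^l u^(l+1-m), where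
   2l is its length, and let M be the generating function of such walks up to
   relabelling. Call a tree edge simple if it is crossed once in each
   direction. Cutting a walk at its first simple edge yields a walk with a
   marked position before which no simple edge occurs, together with an
   arbitrary walk. Iterating over that position gives
     M = Y P(z Y^2, u),   Y = 1 / (1 - z M),
   where P counts the walks without simple edges. Such walks have l at most
   twice the excess l+1-m, so every u-coefficient of P is a polynomial, and
   P(q, u) = 1 + u q^2 + u^2 (q^3 + 6 q^4) + O(u^3).
   Replace z by z(1-u) and write x = z C^2, C = 1 + x, Y = C (1 + e). Then
     (1 - x) e = x ((1 - u) (1 + e)^2 P - 1 - 2 e),
   and, since P = 1 + O(u) and [u]P = q^2, the right-hand side has no term
   linear in (u, e) modulo 1 - x. By induction (1-x)^j [u^j]e lies in (1-x) Q[x]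
   for all j; the orders u and u^2 are explicit. Finally M = C (1 + e) P. *)

(** * Closed words and tree words *)

(** The absence of simple edges is not a condition that can be peeled off edge by edge: a walk cut
    open at a simple edge may contain others on both pieces. Requiring it only before a mark repairs
    this: once the excursion across the first simple edge is removed, the host keeps its mark and
    its condition, and the excursion is unrestricted. So every position of a walk without simple
    edges carries a sequence of excursions, a factor Y; a walk of length 2l has 2l + 1 positions,
    whence the argument z Y^2 of P and the extra factor Y. The equation for e is quadratic with 1 -
    x in front of e. A source term in u that survives at x = 1 would give [u^j]e a pole of order up
    to 2j - 1. The substitution z (1 - u) turns this source, up to the factor x, into x^2 - 1, and
    the order drops to j - 1. Hence [u^i]M / C has a pole of order at most i, and i is at most 2i -
    3 exactly from i = 3 on. The cases i = 1, 2 need an actual cancellation, hence the exact terms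
    of P. *)

Section Steps.
Variable T : eqType.
Implicit Types (c d s t : seq T) (x y : T).

Definition steps c := zip c (behead c).
(* The closed walk v_1, ..., v_L is the word v_1 ... v_L v_1 of size L + 1; thus the
   trivial walk is a one-letter word and the empty word is not closed. *)
Definition closed_word c := if c is x :: s then last x s == x else false.
Definition swap (e : T * T) := (e.2, e.1).

Lemma steps_cons x y s : steps (x :: y :: s) = (x, y) :: steps (y :: s).
Proof. by []. Qed.

Lemma steps_cat s x t : steps (s ++ x :: t) = steps (rcons s x) ++ steps (x :: t).
Proof.
elim: s => [|a s IH] //; case: s IH => [|b s] // IH.
by have /= := congr1 (cons (a, b)) IH.
Qed.

Lemma steps_rcons x s y : steps (rcons (x :: s) y) = rcons (steps (x :: s)) (last x s, y).
Proof. by elim: s x => [|a s IH] x //; have /= := congr1 (cons (x, a)) (IH a). Qed.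

Lemma size_steps c : size (steps c) = (size c).-1.
Proof. by rewrite size_zip size_behead; apply/minn_idPr; exact: leq_pred. Qed.

Lemma mem_steps c e : e \in steps c -> (e.1 \in c) && (e.2 \in c).
Proof.
elim: c => [|a c IH] //; case: c IH => [|b c] IH //.
rewrite steps_cons in_cons => /orP[/eqP -> /=|/IH /andP[h1 h2]].
  by rewrite !in_cons !eqxx orbT.
by rewrite !(in_cons a) h1 h2 !orbT.
Qed.

Lemma steps_insert s x y d t :
  steps (s ++ x :: (y :: d) ++ x :: t) =
    steps (rcons s x) ++ (x, y) :: steps (y :: d) ++ (last y d, x) :: steps (x :: t).
Proof.
rewrite steps_cat cat_cons steps_cons -cat_cons (steps_cat (y :: d)) steps_rcons.
by rewrite cat_rcons.
Qed.

(** [f] marks one side of a cut that only the edge between [x] and [y] crosses; entries minus exits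
    equal the net change of side from the first letter to the last. *)
Lemma count_balance (f : T -> bool) x y a s : ~~ f x -> f y ->
  (forall e, e \in steps (a :: s) -> [|| e == (x, y), e == (y, x) | f e.1 == f e.2]) ->
  f a + count_mem (x, y) (steps (a :: s)) = f (last a s) + count_mem (y, x) (steps (a :: s)).
Proof.
move=> fx fy; elim: s a => [|b s IH] a // H.
have /IH {}IH e : e \in steps (b :: s) -> [|| e == (x, y), e == (y, x) | f e.1 == f e.2].
  by move=> es; apply: H; rewrite steps_cons in_cons es orbT.
have xy : (y == x) = false by apply/eqP => yx; rewrite -yx fy in fx.
have cE (e p : T * T) l : count_mem e (p :: l) = (p == e) + count_mem e l by [].
have := H (a, b); rewrite steps_cons in_cons eqxx => /(_ isT).
rewrite !cE [last _ _]/= !xpair_eqE; case/or3P=> [/andP[/eqP ea /eqP eb]|/andP[/eqP ea /eqP eb]|/eqP /= fab].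
- by move: IH; rewrite ea eb !eqxx xy andbF (negbTE fx) fy; lia.
- by move: IH; rewrite ea eb !eqxx xy /= (negbTE fx) fy; lia.
have -> : (a == x) && (b == y) = false.
  by apply/negP => /andP[/eqP ax /eqP yb]; move: fab; rewrite ax yb fy (negbTE fx).
have -> : (a == y) && (b == x) = false.
  by apply/negP => /andP[/eqP ax /eqP yb]; move: fab; rewrite ax yb fy (negbTE fx).
by rewrite fab !add0n.
Qed.

Lemma stay_false (f : T -> bool) x y a s : f y -> ~~ f a ->
  (forall e, e \in steps (a :: s) -> [|| e == (x, y), e == (y, x) | f e.1 == f e.2]) ->
  (x, y) \notin steps (a :: s) -> all (predC f) (a :: s).
Proof.
move=> fy; elim: s a => [|b s IH] a fa H; first by rewrite /= fa.
rewrite steps_cons in_cons negb_or => /andP[n1 n2].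
rewrite [all _ _]/= fa /=; apply: IH n2.
  have := H (a, b); rewrite steps_cons in_cons eqxx eq_sym (negbTE n1) /=.
  by case/(_ isT)/orP => [/eqP[ay]|/eqP <- //]; rewrite ay fy in fa.
by move=> e es; apply: H; rewrite steps_cons in_cons es orbT.
Qed.
End Steps.

Lemma steps_map (T T' : eqType) (f : T -> T') c :
  steps (map f c) = map (fun e => (f e.1, f e.2)) (steps c).
Proof. by elim: c => [|a [|b c] IH] //; have /= := congr1 (cons (f a, f b)) IH. Qed.

Lemma pair_map_inj (T T' : Type) (f : T -> T') :
  injective f -> injective (fun e : T * T => (f e.1, f e.2)).
Proof. by move=> f_inj [a b] [c d] /= [/f_inj -> /f_inj ->]. Qed.

Lemma leq_mul_size_undup (T : eqType) k (s : seq T) :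
  (forall x, x \in s -> k <= count_mem x s) -> k * size (undup s) <= size s.
Proof.
move=> H; rewrite -[X in _ <= X](perm_size (perm_count_undup s)) size_flatten sumnE /shape.
rewrite !big_map; under [X in _ <= X]eq_bigr do rewrite size_nseq.
have -> : k * size (undup s) = \sum_(x <- undup s) k.
  by rewrite big_const_seq count_predT iter_addn_0.
rewrite !big_seq; apply: leq_sum => x; rewrite mem_undup; exact: H.
Qed.

Lemma first_occurrence (T : eqType) (c : seq T) y :
  y \in c -> exists s1 s2, c = s1 ++ y :: s2 /\ y \notin s1.
Proof.
rewrite -has_pred1 => /split_find[w s1 s2 /eqP-> ys1]; exists s1, s2.
by rewrite cat_rcons -has_pred1.
Qed.

Section Connect.
Variables (T T' : finType).

(** Edges may collapse to a vertex, so that a whole part of a graph can be folded onto one point. *)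
Lemma connect_retract (e : rel T) (e' : rel T') (h : T -> T') :
  (forall u v, e u v -> (h u == h v) || e' (h u) (h v)) ->
  forall u v, connect e u v -> connect e' (h u) (h v).
Proof.
move=> H u v /connectP[p]; elim: p u => [|w p IH] u /= => [_ ->|/andP[uw pw] vE].
  exact: connect0.
apply: connect_trans (IH _ pw vE).
by case/orP: (H _ _ uw) => [/eqP ->|/connect1 //]; exact: connect0.
Qed.
End Connect.

Lemma connect_invariant (T : finType) (T' : eqType) (e : rel T) (f : T -> T') :
  (forall u v, e u v -> f u = f v) -> forall u v, connect e u v -> f u = f v.
Proof.
move=> H u v /connectP[p]; elim: p u => [|w p IH] u /= => [_ -> //|/andP[uw pw] vE].
by rewrite (H _ _ uw); exact: IH.
Qed.

(** * Bridges, crossing numbers and the number of letters of a tree word *)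

Section TreeWalk.
Variable T : finType.
Implicit Types (c d s t : seq T) (x y : T) (e : T * T).

(* The graph of c with the undirected edge e removed. *)
Definition edge_del c e : rel T := fun u v =>
  [&& ((u, v) \in steps c) || ((v, u) \in steps c), (u, v) != e & (v, u) != e].

(* Every edge is a bridge; connectedness is automatic. *)
Definition tree_word c := closed_word c && all (fun e => ~~ connect (edge_del c e) e.1 e.2) (steps c).

Lemma edge_del_sym c e : symmetric (edge_del c e).
Proof. by move=> u v; rewrite /edge_del orbC [X in _ && X]andbC. Qed.

Lemma edge_del_connect_sym c e : connect_sym (edge_del c e).
Proof. exact/sym_connect_sym/edge_del_sym. Qed.

(** Turns the bridge condition into the kind of cut that [count_balance] and [stay_false] take as
    hypothesis. *)
Lemma tree_word_side c x y (f := fun v => connect (edge_del c (x, y)) y v) :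
  tree_word c -> (x, y) \in steps c ->
  [/\ ~~ f x, f y &
      forall e, e \in steps c -> [|| e == (x, y), e == (y, x) | f e.1 == f e.2]].
Proof.
move=> /andP[_ /allP tc] xyc; split; rewrite /f ?connect0 //.
  by rewrite edge_del_connect_sym; exact: (tc _ xyc).
case=> a b abc /=; case: eqVneq => //= n1; case: eqVneq => //= n2; apply/eqP.
apply: (same_connect_r (edge_del_connect_sym c (x, y)) (connect1 _)).
by rewrite /edge_del abc n1 /= xpair_eqE andbC -xpair_eqE.
Qed.

Lemma tree_word_neq c x y : tree_word c -> (x, y) \in steps c -> x != y.
Proof. by move=> tc xyc; have [fx fy _] := tree_word_side tc xyc; apply: contraNneq fx => ->. Qed.

(** A closed walk ends on the side of the bridge where it began, so its net crossing number is
    zero. *)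
Lemma tree_word_count_swap c x y : tree_word c ->
  count_mem (x, y) (steps c) = count_mem (y, x) (steps c).
Proof.
have main a b : tree_word c -> (a, b) \in steps c ->
    count_mem (a, b) (steps c) = count_mem (b, a) (steps c).
  move=> tc abc; have [fx fy fE] := tree_word_side tc abc.
  case: c tc abc fx fy fE => [|z s] // tc abc fx fy fE.
  have /andP[/eqP zE _] := tc.
  by have := count_balance fx fy fE; rewrite zE => /addnI.
move=> tc; have [xyc|xyc] := boolP ((x, y) \in steps c); first exact: main.
have [yxc|yxc] := boolP ((y, x) \in steps c); first by rewrite (main y x).
by rewrite !(count_memPn _).
Qed.

Lemma perm_swap_steps c : tree_word c -> perm_eq (steps c) (map (@swap T) (steps c)).
Proof.
move=> tc; rewrite /perm_eq; apply/allP => -[x y] _ /=; rewrite (tree_word_count_swap _ _ tc).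
apply/eqP; rewrite count_map; apply: eq_count => -[a b] /=.
by rewrite !xpair_eqE andbC.
Qed.

(* First visits to new letters are ascending steps. *)
Definition ascending c : pred (T * T) := fun e => index e.1 c < index e.2 c.

(** Reversal permutes the steps and exchanges ascending with descending ones; no step is neutral,
    because consecutive letters differ. *)
Lemma size_steps_ascending c : tree_word c -> size (steps c) = (count (ascending c) (steps c)).*2.
Proof.
move=> tc; rewrite -(count_predC (ascending c)) -addnn; congr (_ + _).
rewrite (permP (perm_swap_steps tc)) count_map; apply: eq_in_count => -[x y] xyc.
have [/= xc yc] := andP (mem_steps xyc); have := tree_word_neq tc xyc.
rewrite /ascending /=; case: ltngtP => // ixy /eqP[].
by have := congr1 (nth x c) ixy; rewrite !nth_index.
Qed.

Lemma ascending_letters c : size (undup c) <= (size (undup (filter (ascending c) (steps c)))).+1.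
Proof.
case cE: c => [|z s] //; rewrite -cE; set U := undup (filter _ _).
rewrite -(size_map snd U) -/(size (z :: map snd U)).
apply: uniq_leq_size; first exact: undup_uniq.
move=> y; rewrite mem_undup => yc; rewrite in_cons; have [//|yz /=] := eqVneq y z.
have [s1 [s2 [E ys1]]] := @first_occurrence _ c y yc.
case: (lastP s1) ys1 E => [|s1' x] ys1 E.
  by move: yz; move: E; rewrite cE => -[-> _]; rewrite eqxx.
apply/mapP; exists (x, y) => //; rewrite mem_undup mem_filter; apply/andP; split.
  rewrite /ascending /= E !index_cat mem_rcons mem_head in ys1 *.
  by rewrite (negbTE ys1) index_head addn0 index_mem mem_rcons mem_head.
by rewrite E cat_rcons steps_cat steps_cons mem_cat mem_head orbT.
Qed.

(** Each letter but the first is reached by its own ascending step, repeated at least [k] times. The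
    case [k = 1] bounds the number of letters of any tree word; [k = 2] serves words without simple
    edges and makes the u-coefficients of P polynomials. *)
Lemma size_letters k c : tree_word c ->
  (forall e, e \in steps c -> k <= count_mem e (steps c)) ->
  k.*2 * (size (undup c)).-1 <= (size c).-1.
Proof.
move=> tc H; rewrite -(size_steps c) size_steps_ascending // -doubleMl leq_double.
rewrite -size_filter; set U := filter _ _.
apply: leq_trans (leq_mul_size_undup (s := U) (k := k) _); last first.
  move=> e; rewrite mem_filter => /andP[ae es]; apply: leq_trans (H e es) _.
  rewrite /U count_filter; apply: eq_leq; apply: eq_count => e' /=.
  by case: eqP => // ->.
by rewrite leq_mul2l; have := ascending_letters c; rewrite -/U; lia.
Qed.
End TreeWalk.

(** * Hanging a closed word on a letter, and cutting it off again *)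

Section Insert.
Variable T : finType.
Implicit Types (c d s t : seq T) (x y : T) (e : T * T).

Lemma closed_word_insert s x d t : closed_word (s ++ x :: d ++ x :: t) = closed_word (s ++ x :: t).
Proof. by case: s => [|a s]; rewrite /= !last_cat /= ?last_cat. Qed.

Lemma connect_contract c c' (h : T -> T) e :
  (forall u v, (u, v) \in steps c -> h u = h v \/ [/\ h u = u, h v = v & (u, v) \in steps c']) ->
  forall a b, connect (edge_del c e) a b -> connect (edge_del c' e) (h a) (h b).
Proof.
move=> H; apply: connect_retract => u v /and3P[/orP[] /H[->|[hu hv uv]] n1 n2];
  by rewrite ?eqxx // hu hv /edge_del uv n1 n2 ?orbT.
Qed.

(** The two parts are joined by a single new edge. Contracting one part to its end of that edge
    sends a detour around an edge of the other part to a detour inside the other part. *)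
Lemma tree_word_insert s x d t : closed_word d -> {in d, forall v, v \notin s ++ x :: t} ->
  tree_word (s ++ x :: d ++ x :: t) = tree_word (s ++ x :: t) && tree_word d.
Proof.
case: d => [|y d'] // cd disj; set c := s ++ _; set c1 := s ++ _; set d := y :: d' in cd disj *.
have yd' : last y d' = y by apply/eqP.
have stc : steps c = steps (rcons s x) ++ (x, y) :: steps d ++ (y, x) :: steps (x :: t).
  by rewrite /c steps_insert yd'.
have stc1 : steps c1 = steps (rcons s x) ++ steps (x :: t) by rewrite /c1 steps_cat.
have mem_c e : (e \in steps c) = [|| e \in steps c1, e \in steps d, e == (x, y) | e == (y, x)].
  rewrite stc stc1 !(mem_cat, in_cons).
  case: (e \in steps (rcons s x)); case: (e \in steps (x :: t)); case: (e \in steps d);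
    by case: (e == (x, y)); case: (e == (y, x)).
have in_c1 e : e \in steps c1 -> (e.1 \notin d) && (e.2 \notin d).
  move=> /mem_steps /andP[h1 h2]; apply/andP; split; apply/negP => /disj; by rewrite ?h1 ?h2.
have in_d e : e \in steps d -> (e.1 \in d) && (e.2 \in d) by exact: mem_steps.
have xd : x \notin d by apply/negP => /disj; rewrite mem_cat mem_head orbT.
have yd : y \in d by rewrite mem_head.
rewrite /tree_word {1}/c closed_word_insert -/c1 cd /=.
apply/idP/idP => [/andP[cc /allP H]|/andP[/andP[cc /allP H1] /allP H2]].
  rewrite cc /=; apply/andP; split; apply/allP => e es;
    (have ec : e \in steps c by rewrite mem_c es ?orbT); move: (H e ec); apply: contra;
    apply: connect_sub => u v /and3P[uv n1 n2]; apply: connect1; rewrite /edge_del n1 n2 !mem_c;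
    by case/orP: uv => ->; rewrite ?orbT.
rewrite cc; apply/allP => -[a b]; rewrite mem_c => /or4P[ab|ab|/eqP [-> ->]|/eqP [-> ->]] /=.
- have /= /andP[ad bd] := in_c1 _ ab.
  (* An edge of the host: fold [d] onto the letter [x] on which it hangs. *)
  pose h v := if v \in d then x else v.
  have hK v : v \notin d -> h v = v by rewrite /h => /negbTE ->.
  have hx v : v \in d -> h v = x by rewrite /h => ->.
  have ctr u v : (u, v) \in steps c ->
      h u = h v \/ [/\ h u = u, h v = v & (u, v) \in steps c1].
    rewrite mem_c => /or4P[uv|uv|/eqP [-> ->]|/eqP [-> ->]].
    + by have /andP[ud vd] := in_c1 _ uv; right; rewrite !hK.
    + by have /andP[ud vd] := in_d _ uv; left; rewrite !hx.
    + by left; rewrite (hx y) // hK.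
    + by left; rewrite (hx y) // hK.
  apply/negP => /(connect_contract ctr); rewrite (hK a) // (hK b) //.
  exact/negP/(H1 _ ab).
- have /= /andP[ad bd] := in_d _ ab.
  (* An edge of [d]: fold the host onto the first letter of [d]. *)
  pose h v := if v \in d then v else y.
  have hK v : v \in d -> h v = v by rewrite /h => ->.
  have hx v : v \notin d -> h v = y by rewrite /h => /negbTE ->.
  have ctr u v : (u, v) \in steps c ->
      h u = h v \/ [/\ h u = u, h v = v & (u, v) \in steps d].
    rewrite mem_c => /or4P[uv|uv|/eqP [-> ->]|/eqP [-> ->]].
    + by have /andP[ud vd] := in_c1 _ uv; left; rewrite !hx.
    + by have /andP[ud vd] := in_d _ uv; right; rewrite !hK.
    + by left; rewrite (hx x) // hK.
    + by left; rewrite (hx x) // hK.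
  apply/negP => /(connect_contract ctr); rewrite (hK a) // (hK b) //.
  exact/negP/(H2 _ ab).
(* The joining edge: without it no edge leaves the letters of [d]. *)
- suff inv u v : edge_del c (x, y) u v -> (u \in d) = (v \in d).
    by apply/negP => /(connect_invariant inv); rewrite (negbTE xd) yd.
  move=> /and3P[uv n1 n2]; move: uv; rewrite !mem_c (negbTE n1) (negbTE n2) /=.
  rewrite !xpair_eqE [(u == y) && _]andbC [(v == y) && _]andbC -!xpair_eqE.
  rewrite (negbTE n1) (negbTE n2) !orbF => /orP[/orP[/in_c1|/in_d]|/orP[/in_c1|/in_d]] /= /andP[];
    by do ?[move=> /negbTE -> /negbTE -> | move=> -> ->].
- suff inv u v : edge_del c (y, x) u v -> (u \in d) = (v \in d).
    by apply/negP => /(connect_invariant inv); rewrite (negbTE xd) yd.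
  move=> /and3P[uv n1 n2]; move: uv; rewrite !mem_c (negbTE n1) (negbTE n2) /=.
  rewrite !xpair_eqE [(u == x) && _]andbC [(v == x) && _]andbC -!xpair_eqE.
  rewrite (negbTE n1) (negbTE n2) !orbF => /orP[/orP[/in_c1|/in_d]|/orP[/in_c1|/in_d]] /= /andP[];
    by do ?[move=> /negbTE -> /negbTE -> | move=> -> ->].
Qed.

(* In a tree word an edge is crossed equally often in both directions, so it is simple
   iff each of its two orientations occurs exactly once among the steps. *)
Definition unsimple i c := all (fun e => count_mem e (steps c) != 1) (take i (steps c)).

Lemma take_steps s x t : take (size s) (steps (s ++ x :: t)) = steps (rcons s x).
Proof.
by rewrite steps_cat take_size_cat // size_steps size_rcons.
Qed.

Lemma steps_rcons2 s x y : steps (rcons (rcons s x) y) = rcons (steps (rcons s x)) (x, y).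
Proof. by case: s => [|a s] //; rewrite rcons_cons steps_rcons last_rcons. Qed.

Lemma unsimpleS s x y t : unsimple (size s).+1 (s ++ x :: y :: t) =
  unsimple (size s) (s ++ x :: y :: t) && (count_mem (x, y) (steps (s ++ x :: y :: t)) != 1).
Proof.
rewrite /unsimple take_steps; set c := s ++ _.
have -> : take (size s).+1 (steps c) = rcons (steps (rcons s x)) (x, y).
  by rewrite -steps_rcons2 -(size_rcons s x) /c -cat_rcons take_steps.
by rewrite all_rcons andbC.
Qed.

(** Steps before the insertion avoid the letters of [d] and keep their multiplicity, while the step
    into [d] reaches a fresh letter and occurs exactly once. So the insertion creates the first
    simple edge precisely at the mark. *)
Lemma unsimple_insert s x d t : closed_word d -> {in d, forall v, v \notin s ++ x :: t} ->
  unsimple (size s) (s ++ x :: d ++ x :: t) = unsimple (size s) (s ++ x :: t) /\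
  ~~ unsimple (size s).+1 (s ++ x :: d ++ x :: t).
Proof.
case: d => [|y d'] // cd disj; have yd' : last y d' = y by apply/eqP.
have xc : x \in s ++ x :: t by rewrite mem_cat mem_head orbT.
have yc : y \notin s ++ x :: t by apply: disj; rewrite mem_head.
have cnt e : count_mem e (steps (s ++ x :: (y :: d') ++ x :: t)) =
    count_mem e (steps (s ++ x :: t)) + count_mem e (steps (y :: d')) + ((x, y) == e) + ((y, x) == e).
  by rewrite steps_insert yd' steps_cat !count_cat /= count_cat /=; lia.
have d0 e : (e.1 \in s ++ x :: t) || (e.2 \in s ++ x :: t) -> count_mem e (steps (y :: d')) = 0.
  move=> h; apply/count_memPn/negP => /mem_steps /andP[/disj n1 /disj n2].
  by move: h; rewrite (negbTE n1) (negbTE n2).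
have c0 e : (e.1 \notin s ++ x :: t) || (e.2 \notin s ++ x :: t) -> count_mem e (steps (s ++ x :: t)) = 0.
  move=> h; apply/count_memPn/negP => /mem_steps /andP[n1 n2].
  by move: h; rewrite n1 n2.
split.
  rewrite /unsimple !take_steps; apply: eq_in_all => -[a b] /mem_steps /= /andP[ai bi].
  have sub v : v \in rcons s x -> v \in s ++ x :: t by rewrite -cat_rcons mem_cat => ->.
  rewrite cnt d0 /= ?sub // addn0 !xpair_eqE.
  have -> : (y == b) = false by apply: contraNF yc => /eqP ->; exact: sub.
  have -> : (y == a) = false by apply: contraNF yc => /eqP ->; exact: sub.
  by rewrite andbF !addn0.
rewrite unsimpleS negb_and negbK cnt c0 /= ?yc ?orbT // d0 /= ?xc // eqxx !xpair_eqE.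
by have -> : (y == x) = false by [apply: contraNF yc => /eqP ->]; rewrite /= orbT.
Qed.

(* The letters separated from x by the first simple edge (x, y) form one factor d. *)
Lemma tree_word_split c i : tree_word c -> i.+1 < size c -> unsimple i c -> ~~ unsimple i.+1 c ->
  exists s x d t, [/\ c = s ++ x :: d ++ x :: t, size s = i, closed_word d &
    {in d, forall v, v \notin s ++ x :: t}].
Proof.
move=> tc ic.
have [s [x [y [r [cE si]]]]] : exists s x y r, c = s ++ x :: y :: r /\ size s = i.
  case: c {tc} ic => [|z c0] // ic; set c := z :: c0 in ic *.
  exists (take i c), (nth z c i), (nth z c i.+1), (drop i.+2 c).
  by rewrite -!drop_nth ?cat_take_drop // ?size_take; [rewrite (ltnW ic) | exact: ltnW].
rewrite -si cE unsimpleS => us; rewrite us /= negbK -cE => /eqP cnt1.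
have xyc : (x, y) \in steps c by rewrite -has_pred1 has_count cnt1.
have cnt2 := cnt1; rewrite (tree_word_count_swap _ _ tc) in cnt2.
set f := fun v => connect (edge_del c (x, y)) y v.
have [fx fy fE] := tree_word_side tc xyc; rewrite -!/(f _) in fx fy; rewrite -/f in fE.
have stc : steps c = steps (rcons s x) ++ (x, y) :: steps (y :: r) by rewrite cE steps_cat steps_cons.
have cntE e p (l : seq (T * T)) : count_mem e (p :: l) = (p == e) + count_mem e l by [].
move: cnt1; rewrite stc count_cat cntE eqxx add1n addnS => -[] /eqP; rewrite addn_eq0 => /andP[/eqP cntl /eqP cntr].
have n1 : (x, y) \notin steps (rcons s x) by apply/count_memPn.
have n2 : (x, y) \notin steps (y :: r) by apply/count_memPn.
have fE1 e : e \in steps (rcons s x) -> [|| e == (x, y), e == (y, x) | f e.1 == f e.2].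
  by move=> es; apply: fE; rewrite stc mem_cat es.
have fE2 e : e \in steps (y :: r) -> [|| e == (x, y), e == (y, x) | f e.1 == f e.2].
  by move=> es; apply: fE; rewrite stc mem_cat in_cons es !orbT.
have n3 : (y, x) \notin steps (rcons s x).
  apply/negP => yx; move: us; rewrite /unsimple take_steps => /allP /(_ _ yx).
  by rewrite -cE cnt2.
have [z [p pE]] : exists z p, rcons s x = z :: p.
  by case: (s) => [|a s']; [exists x, [::] | exists a, (rcons s' x); rewrite rcons_cons].
have zx : last z p = x by rewrite -[LHS]/(last z (z :: p)) -pE last_rcons.
have cE' : c = z :: p ++ y :: r by rewrite -cat_cons -pE cE cat_rcons.
rewrite pE in n1 n3 fE1.
(* The prefix crosses the bridge in neither direction and ends at [x], so it begins on the side of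
   [x]. *)
have fz : ~~ f z.
  have := count_balance fx fy fE1; rewrite zx (negbTE fx) (count_memPn n1) (count_memPn n3).
  by rewrite !addn0; case: (f z).
have /allP all1 := stay_false fy fz fE1 n1.
(* The word is closed, so it also ends on that side; hence it must return from the side of [y]. *)
have f_last : ~~ f (last y r).
  by case/andP: tc => + _; rewrite cE' /closed_word last_cat /= => /eqP ->.
have : has (predC f) (y :: r) by apply/hasP; exists (last y r) => //; exact: mem_last.
move E : (y :: r) => yr hs; case/split_find: hs E => w d t /= fw fd E.
have {}fd v : v \in d -> f v by move=> vd; apply: contraNT fd => fv; apply/hasP; exists v.
rewrite cat_rcons in E.
case: d fd E => [|y' d'] fd E; first by case: E fw => <-; rewrite fy.
have y'y : y' = y by case: E. subst y'; set d := y :: d' in fd E.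
have st2 : steps (y :: r) = steps (rcons d w) ++ steps (w :: t) by rewrite E steps_cat.
(* The first return changes sides and cannot use [(x, y)], which has already had its only
   occurrence. *)
have lw : (last y d', w) = (y, x).
  have lin : (last y d', w) \in steps (y :: r).
    by rewrite st2 mem_cat steps_rcons mem_rcons mem_head.
  have /or3P[/eqP lE|/eqP //|/eqP /= lE] := fE2 _ lin.
    by move: n2; rewrite -lE lin.
  by move: fw; rewrite -lE fd // mem_last.
case: lw => ly wx; subst w.
have all2 : all (predC f) (x :: t).
  apply: (stay_false fy fx) => [e es|]; first by apply: fE2; rewrite st2 mem_cat es orbT.
  by apply: contra n2; rewrite st2 mem_cat => ->; rewrite orbT.
exists s, x, d, t; split => //.
- by rewrite cE E.
- by rewrite /= ly.
- move=> v /fd fv; rewrite -cat_rcons mem_cat negb_or pE; apply/andP; split.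
    by apply/negP => /all1 /=; rewrite fv.
  apply/negP => vt; have /allP/(_ v) := all2.
  by rewrite in_cons vt orbT /= fv => /(_ isT).
Qed.

(** The two slices overlap in the letter at position [i], which is thus repeated: the walk leaves
    it, traverses [d] and comes back to it. *)
Definition insert_at i c d := take i.+1 c ++ d ++ drop i c.

Lemma insert_atE s x t d : insert_at (size s) (s ++ x :: t) d = s ++ x :: d ++ x :: t.
Proof.
rewrite /insert_at drop_size_cat // -cat_rcons -(size_rcons s x) take_size_cat //.
by rewrite cat_rcons.
Qed.

Lemma split_at i c : i < size c -> exists s x t, c = s ++ x :: t /\ size s = i.
Proof.
case: c => // z c; set c' := z :: c => ic.
exists (take i c'), (nth z c' i), (drop i.+1 c').
by rewrite -drop_nth ?cat_take_drop // size_takel // ltnW.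
Qed.

(** Where the inserted word ends can be read off: it is followed by a host letter, and a longer
    candidate would contain that letter. *)
Lemma insert_at_inj i c1 c2 d1 d2 : i < size c1 -> i < size c2 ->
  {in d1, forall v, v \notin c1} -> {in d2, forall v, v \notin c2} ->
  insert_at i c1 d1 = insert_at i c2 d2 -> c1 = c2 /\ d1 = d2.
Proof.
wlog le : c1 c2 d1 d2 / size d1 <= size d2.
  move=> W i1 i2 D1 D2 E; have [le|/ltnW le] := leqP (size d1) (size d2); first exact: W.
  by have [] := W _ _ _ _ le i2 i1 D2 D1 (esym E).
move=> /split_at [s1 [x1 [t1 [-> s1i]]]] /split_at [s2 [x2 [t2 [-> s2i]]]] D1 D2.
rewrite -{1}s1i -{1}s2i !insert_atE => /eqP; rewrite eqseq_cat ?s1i ?s2i // => /andP[/eqP ss].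
rewrite ss in D1 *; rewrite eqseq_cons => /andP[/eqP xx /eqP]; rewrite xx in D1 *.
move=> E; have Et := congr1 (take (size d1)) E; have Ed := congr1 (drop (size d1)) E.
rewrite take_size_cat // takel_cat // in Et; rewrite drop_size_cat // in Ed.
have dd : drop (size d1) (d2 ++ x2 :: t2) = drop (size d1) d2 ++ x2 :: t2.
  by rewrite -{1}(cat_take_drop (size d1) d2) -Et -catA drop_size_cat.
rewrite dd in Ed; case Ew : (drop (size d1) d2) Ed => [|w r].
  by case=> ->; split=> //; rewrite -[RHS](cat_take_drop (size d1)) Ew cats0.
rewrite cat_cons => -[xw _].
have : w \in d2 by rewrite -(cat_take_drop (size d1) d2) Ew mem_cat mem_head orbT.
by move/D2; rewrite -xw mem_cat mem_head orbT.
Qed.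
End Insert.

(** * Counting words with a prescribed set of letters *)

Section Words.
Variable T : finType.
Implicit Types (c d s t : seq T) (P : pred (seq T)) (A B : {set T}).

Fixpoint words n : seq (seq T) :=
  if n is n'.+1 then [seq x :: c | x <- enum T, c <- words n'] else [:: [::]].

Lemma mem_words n c : (c \in words n) = (size c == n).
Proof.
elim: n c => [|n IH] [|x c] //=; first by apply/allpairsP => -[[x d] []].
apply/allpairsP/idP => [[[y d] /= [_ + [_ ->]]]|cn]; first by rewrite IH.
by exists (x, c); rewrite mem_enum IH.
Qed.

Lemma uniq_words n : uniq (words n).
Proof.
elim: n => [|n IH] //=; apply: allpairs_uniq => //; first exact: enum_uniq.
by move=> [a c] [b d] _ _ /= [-> ->].
Qed.

Definition letters c : {set T} := [set x in c].

Definition words_on P A n := [seq c <- words n | P c && (letters c == A)].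
Definition num_words P A n := size (words_on P A n).

Lemma mem_words_on P A n c : (c \in words_on P A n) = [&& P c, letters c == A & size c == n].
Proof. by rewrite mem_filter mem_words andbA. Qed.

Lemma uniq_words_on P A n : uniq (words_on P A n).
Proof. exact/filter_uniq/uniq_words. Qed.

Lemma num_eq0 P A n : (forall c, P c -> letters c = A -> size c = n -> False) -> num_words P A n = 0.
Proof.
move=> H; apply/eqP; rewrite size_eq0; apply/negPn; rewrite -has_filter.
by apply/hasPn => c; rewrite mem_words => /eqP cn; apply/negP => /andP[Pc /eqP cA]; exact: (H c).
Qed.

Lemma eq_num P P' A n : (forall c, size c = n -> letters c = A -> P c = P' c) ->
  num_words P A n = num_words P' A n.
Proof.
move=> H; congr size; apply: eq_in_filter => c; rewrite mem_words => /eqP cn.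
by case: (letters c =P A) => [cA|]; rewrite ?andbF // (H c).
Qed.

Lemma num_add P P1 P2 A n :
  (forall c, size c = n -> letters c = A -> P c = P1 c (+) P2 c /\ ~~ (P1 c && P2 c)) ->
  num_words P A n = num_words P1 A n + num_words P2 A n.
Proof.
move=> H; rewrite /num_words !size_filter.
have {}H c : c \in words n -> letters c = A -> P c = P1 c (+) P2 c /\ ~~ (P1 c && P2 c).
  by rewrite mem_words => /eqP; exact: H.
elim: (words n) H => [|c s IH] H //=; rewrite IH; last first.
  by move=> d ds; apply: H; rewrite in_cons ds orbT.
case: eqP => [cA|_]; last by rewrite !andbF !add0n.
have [-> +] := H c (mem_head _ _) cA; rewrite !andbT.
by case: (P1 c); case: (P2 c) => //= _; rewrite ?add0n // ?add1n ?addSn ?addnS.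
Qed.

(** Here [i] is the marked position. It may be the last letter, in which case every step lies before
    the mark and the word is reduced. *)
Definition unsimple_upto i c := [&& tree_word c, i < size c & unsimple i c].
Definition simple_at i c := [&& tree_word c, i.+1 < size c, unsimple i c & ~~ unsimple i.+1 c].
Definition reduced_word c := tree_word c && unsimple (size c).-1 c.

Lemma unsimple_pred i c : unsimple i.+1 c -> unsimple i c.
Proof.
move=> /allP H; apply/allP => e ei; apply: H; move: ei.
by rewrite -[i.+1]addn1 takeD mem_cat => ->.
Qed.

(** Exactly one of three things happens: the mark can advance, it has reached the last letter, or
    the next edge is simple. *)
Lemma num_unsimple_upto i A n :
  num_words (unsimple_upto i) A n = num_words (unsimple_upto i.+1) A n + (n == i.+1) * num_words reduced_word A n + num_words (simple_at i) A n.
Proof.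
have [ni|ni] := eqVneq n i.+1.
  rewrite mul1n [num_words (unsimple_upto i.+1) _ _]num_eq0; last by move=> c /and3P[_ ic _] _ cn; move: ic; rewrite cn ni ltnn.
  rewrite [num_words (simple_at i) _ _]num_eq0; last by move=> c /and4P[_ ic _ _] _ cn; move: ic; rewrite cn ni ltnn.
  by rewrite addn0 add0n; apply: eq_num => c cn _; rewrite /unsimple_upto /reduced_word cn ni /= leqnn.
rewrite mul0n addn0; apply: num_add => c cn _; rewrite /unsimple_upto /simple_at cn.
have -> : (i.+1 < n) = (i < n) by rewrite ltn_neqAle eq_sym ni.
case: (tree_word c) => //=; case: (i < n) => //=.
by have := @unsimple_pred i c; case: (unsimple i c); case: (unsimple i.+1 c) => // /(_ isT).
Qed.

(** [insert_at] is a bijection from pairs of a marked host and an excursion on complementary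
    letters. The sizes [k] and [n - k] add up to one less than the total because the host letter is
    repeated. *)
Lemma num_simple_at i A n : num_words (simple_at i) A n.+1 =
  \sum_(B in powerset A) \sum_(k < n.+1) num_words (unsimple_upto i) B k * num_words (@tree_word T) (A :\: B) (n - k).
Proof.
pose idx := [seq (B, k) | B <- enum (powerset A), k <- iota 0 n.+1].
pose prs (b : {set T} * nat) :=
  [seq (c, d) | c <- words_on (unsimple_upto i) b.1 b.2, d <- words_on (@tree_word T) (A :\: b.1) (n - b.2)].
pose G := [seq insert_at i z.1 z.2 | b <- idx, z <- prs b].
have prsP b c d : (c, d) \in prs b -> [/\ unsimple_upto i c, letters c = b.1, size c = b.2 &
    [/\ tree_word d, letters d = A :\: b.1 & size d = n - b.2]].
  case/allpairsP => -[c' d'] [/= + + [-> ->]].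
  by rewrite !mem_words_on => /and3P[? /eqP ? /eqP ?] /and3P[? /eqP ? /eqP ?].
have disj b c d : (c, d) \in prs b -> {in d, forall v, v \notin c}.
  case/prsP => _ cb _ [_ db _] v vd; apply/negP => vc.
  have : v \in letters d by rewrite inE.
  by rewrite db inE -cb inE vc.
have idxP b : (b \in idx) = (b.1 \subset A) && (b.2 <= n).
  case: b => B k; apply/allpairsP/andP => [[[B' k'] [hB hk [-> ->]]]|[BA kn]].
    by move: hB hk; rewrite mem_enum powersetE mem_iota add0n ltnS.
  by exists (B, k); rewrite mem_enum powersetE mem_iota add0n ltnS.
have -> : num_words (simple_at i) A n.+1 = size G.
  apply/perm_size/uniq_perm; first exact: uniq_words_on.
    apply: allpairs_uniq_dep.
    - apply: allpairs_uniq; [exact: enum_uniq | exact: iota_uniq |].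
      by move=> [? ?] [? ?].
    - move=> b _; apply: allpairs_uniq; [exact: uniq_words_on | exact: uniq_words_on |].
      by move=> [? ?] [? ?].
    move=> z1 z2 /allpairsPdep[b1 [[c1 d1] [_ p1 ->]]] /allpairsPdep[b2 [[c2 d2] [_ p2 ->]]] /= E.
    have [h1 l1 s1 _] := prsP _ _ _ p1; have [h2 l2 s2 _] := prsP _ _ _ p2.
    have [ec ed] : c1 = c2 /\ d1 = d2.
      apply: (insert_at_inj _ _ (disj _ _ _ p1) (disj _ _ _ p2) E); first by case/and3P: h1.
      by case/and3P: h2.
    have eb : b1 = b2 by case: b1 b2 l1 s1 l2 s2 {p1 p2} => ? ? [? ?] /= <- <- <- <-; rewrite ec.
    by subst.
  move=> c; rewrite mem_words_on; apply/idP/allpairsPdep.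
    case/and3P=> /and4P[tc ic us nus] /eqP cA /eqP cn.
    have [s [x [d [t [cE si cd dj]]]]] := tree_word_split tc ic us nus.
    move: tc; rewrite cE tree_word_insert // => /andP[tc1 td].
    have szE : n = size (s ++ x :: t) + size d.
      by apply/eqP; rewrite -eqSS -cn cE !size_cat /= size_cat /=; lia.
    have lE : letters (s ++ x :: t) :|: letters d = A.
      rewrite -cA cE; apply/setP => v; rewrite !inE !(mem_cat, in_cons).
      by case: (v \in s); case: (v == x); case: (v \in t); case: (v \in d).
    exists (letters (s ++ x :: t), size (s ++ x :: t)), (s ++ x :: t, d); split.
    - by rewrite idxP -lE subsetUl szE leq_addr.
    - apply: allpairs_f; rewrite mem_words_on /= ?eqxx ?andbT.
        rewrite /unsimple_upto tc1 -si /= -(unsimple_insert cd dj).1 -cE si us size_cat /= si; lia.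
      rewrite td /=; apply/andP; split; last by rewrite szE addKn.
      apply/eqP/setP => v; rewrite -lE !inE.
      by have [vd|] := boolP (v \in d); [rewrite (dj v vd) orbT | rewrite orbF andNb].
    by rewrite /= -si insert_atE.
  case=> [[B k] [[c1 d] [+ p ->]]]; rewrite idxP /= => /andP[BA kn].
  have dj := disj _ _ _ p; have [/and3P[tc1 ic1 us] cB ck [td dB dn]] := prsP _ _ _ p.
  rewrite /= in cB ck dB dn.
  have [s [x [t [cE si]]]] := split_at ic1.
  have cd : closed_word d by case/andP: td.
  rewrite cE in dj; rewrite -si cE insert_atE; have [u1 u2] := unsimple_insert cd dj.
  rewrite /simple_at tree_word_insert // -cE tc1 td u1 -cE si us -si u2 /=.
  have d0 : 0 < size d by case: (d) cd.
  apply/and3P; split.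
  - by rewrite !size_cat /= size_cat /=; lia.
  - rewrite -(setID A B) (setIidPr BA) -dB -cB cE; apply/eqP/setP => v.
    rewrite !inE !(mem_cat, in_cons).
    by case: (v \in s); case: (v == x); case: (v \in t); case: (v \in d).
  - move: ck; rewrite cE !size_cat /= size_cat /= dn => ck; apply/eqP; lia.
rewrite size_allpairs_dep sumnE big_map big_allpairs_dep /= big_enum /=.
apply: eq_bigr => B _.
rewrite -(big_mkord xpredT (fun k => num_words (unsimple_upto i) B k * num_words (@tree_word T) (A :\: B) (n - k))).
rewrite /index_iota subn0 -/(iota 0 n.+1).
by apply: eq_bigr => k _; rewrite size_allpairs.
Qed.
End Words.

(** * Invariance under relabelling; counts by number of letters *)

Section Relabel.
Variables (T T' : finType) (f : T -> T').
Hypothesis f_inj : injective f.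

Lemma closed_word_map c : closed_word (map f c) = closed_word c.
Proof. by case: c => [|x s] //=; rewrite last_map (inj_eq f_inj). Qed.

Lemma connect_edge_del_map c e :
  connect (edge_del (map f c) (f e.1, f e.2)) (f e.1) (f e.2) = connect (edge_del c e) e.1 e.2.
Proof.
have memf u v : ((f u, f v) \in steps (map f c)) = ((u, v) \in steps c).
  by rewrite steps_map (mem_map (pair_map_inj f_inj) _ (u, v)).
have eqf u v : ((f u, f v) == (f e.1, f e.2)) = ((u, v) == e).
  by case: e => a b; rewrite !xpair_eqE !(inj_eq f_inj).
have wf u v : edge_del (map f c) (f e.1, f e.2) (f u) (f v) = edge_del c e u v.
  by rewrite /edge_del !memf !eqf.
apply/idP/idP => [|]; last first.
  by apply: connect_retract => u v uv; rewrite wf uv orbT.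
(* A left inverse of [f]; the default is harmless, since letters outside the image lie on no
   edge. *)
pose h v := if [pick u | f u == v] is Some u then u else e.1.
have hK u : h (f u) = u.
  by rewrite /h; case: pickP => [w /eqP /f_inj //|/(_ u)]; rewrite eqxx.
suff hw u v : edge_del (map f c) (f e.1, f e.2) u v -> (h u == h v) || edge_del c e (h u) (h v).
  by move=> /(connect_retract hw); rewrite !hK.
move=> uv; have [[u' uE] [v' vE]] : (exists u', u = f u') /\ (exists v', v = f v').
  have m v0 : v0 \in map f c -> exists w, v0 = f w by case/mapP => w _ ->; exists w.
  by case/and3P: (uv) => /orP[] /mem_steps /= /andP[/m ? /m ?] _ _.
by rewrite uE vE !hK -wf -uE -vE uv orbT.
Qed.

Lemma tree_word_map c : tree_word (map f c) = tree_word c.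
Proof.
rewrite /tree_word closed_word_map steps_map all_map; congr (_ && _).
by apply: eq_all => e /=; rewrite connect_edge_del_map.
Qed.

Lemma unsimple_map i c : unsimple i (map f c) = unsimple i c.
Proof.
rewrite /unsimple steps_map -map_take all_map; apply: eq_all => e /=.
by rewrite count_map; congr (_ != 1); apply: eq_count => e' /=; rewrite (inj_eq (pair_map_inj f_inj)).
Qed.

Lemma num_map (P : pred (seq T)) (P' : pred (seq T')) A n :
  (forall c, P' (map f c) = P c) -> num_words P A n = num_words P' [set f x | x in A] n.
Proof.
move=> PP'; rewrite /num_words -(size_map (map f)); apply/perm_size/uniq_perm; last first.
- move=> c; rewrite mem_words_on; apply/mapP/and3P => [[d + ->]|[Pc /eqP cA cn]].
    rewrite mem_words_on PP' size_map => /and3P[-> /eqP <- ->]; split=> //.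
    apply/eqP/setP => v; rewrite inE; apply/mapP/imsetP => -[w wd ->];
      by exists w => //; move: wd; rewrite inE.
  have [d cE] : exists d, c = map f d.
    have : {subset c <= codom f}.
      move=> v vc; have : v \in letters c by rewrite inE.
      by rewrite cA => /imsetP[w _ ->]; exact: codom_f.
    elim: (c) => [|a s IH] sub; first by exists [::].
    have [|d ->] := IH; first by move=> v vs; apply: sub; rewrite in_cons vs orbT.
    by have /codomP[w ->] := sub a (mem_head _ _); exists (w :: d).
  exists d => //; rewrite mem_words_on -PP' -cE Pc /=; move: cn; rewrite cE size_map => ->.
  rewrite andbT; apply/eqP/setP => v; move/setP/(_ (f v)): cA.
  by rewrite cE !inE (mem_map f_inj) (mem_imset _ _ f_inj).
- exact: uniq_words_on.
- by rewrite map_inj_uniq ?uniq_words_on //; exact/inj_map.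
Qed.
End Relabel.

(** The predicate ranges over all finite types so that a count on a letter set can be moved to the
    ordinal of the same cardinality. *)
Definition cnt (P : forall T : finType, pred (seq T)) m n := num_words (P 'I_m) setT n.

Lemma numE (P : forall T : finType, pred (seq T)) (T : finType) (A : {set T}) n :
  (forall (T T' : finType) (f : T -> T') c, injective f -> P T' (map f c) = P T c) ->
  num_words (P T) A n = cnt P #|A| n.
Proof.
move=> Pf; rewrite /cnt (@num_map _ T (@enum_val T (mem A)) enum_val_inj _ (P T)).
  congr num_words; apply/setP => x; apply/idP/imsetP => [xA|[i _ ->]]; last exact: enum_valP.
  by exists (enum_rank_in xA x) => //; rewrite enum_rankK_in.
by move=> c; apply: Pf; exact: enum_val_inj.
Qed.

Definition cntH i := cnt (fun T => @unsimple_upto T i).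
Definition cntT := cnt (fun T => @tree_word T).
Definition cntR := cnt (fun T => @reduced_word T).

(** Relabelling makes the summand depend on the letter set of the host only through its cardinality;
    the binomial counts such sets. *)
Lemma cntH_rec i m n : cntH i m n.+1 = cntH i.+1 m n.+1 + (n == i) * cntR m n.+1 +
  \sum_(j < m.+1) 'C(m, j) * \sum_(k < n.+1) cntH i j k * cntT (m - j) (n - k).
Proof.
rewrite /cntH {1}/cnt num_unsimple_upto eqSS; congr (_ + _); rewrite num_simple_at.
have Hf (T T' : finType) (f : T -> T') c : injective f -> unsimple_upto i (map f c) = unsimple_upto i c.
  by move=> fi; rewrite /unsimple_upto tree_word_map // size_map unsimple_map.
have Tf (T T' : finType) (f : T -> T') c : injective f -> tree_word (map f c) = tree_word c by move=> /tree_word_map.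
under eq_bigr => B _ do under eq_bigr => k _ do
  rewrite (numE _ _ Hf) (numE _ _ Tf) cardsDS ?subsetT // cardsT card_ord.
rewrite (partition_big (fun B : {set 'I_m} => inord #|B| : 'I_m.+1) xpredT) //=.
apply: eq_bigr => j _.
have cB (B : {set 'I_m}) : (inord #|B| == j) = (#|B| == j :> nat).
  by rewrite -val_eqE /= inordK // ltnS -[X in _ <= X]card_ord max_card.
rewrite (eq_bigr (fun=> \sum_(k < n.+1) cntH i j k * cntT (m - j) (n - k))).
  rewrite sum_nat_const; congr (_ * _); rewrite -[X in 'C(X, _)]card_ord -cardsT -cards_draws.
  by apply: eq_card => B; rewrite [LHS]unfold_in powersetE cB !inE.
by move=> B /andP[_]; rewrite cB => /eqP ->.
Qed.

Lemma cntH0 m n : cntH 0 m n = cntT m n.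
Proof.
apply: eq_num => c _ _; rewrite /unsimple_upto /unsimple take0 andbT.
by case: c => [|x s]; rewrite ?andbF ?andbT.
Qed.

Lemma card_letters (T : finType) (c : seq T) : #|letters c| = size (undup c).
Proof. by rewrite cardsE -(card_uniqP (undup_uniq c)); apply: eq_card => x; rewrite mem_undup. Qed.

Lemma size_undup_letters m (c : seq 'I_m) : letters c = setT -> size (undup c) = m.
Proof. by move=> cT; rewrite -card_letters cT cardsT card_ord. Qed.

Lemma tree_word_size (T : finType) (c : seq T) : tree_word c -> 0 < size c /\ ~~ odd (size c).-1.
Proof.
move=> tc; split; first by case/andP: tc; case: c.
by rewrite -size_steps size_steps_ascending // odd_double.
Qed.

Lemma cntT_eq0 m n : ~~ [&& 0 < m, odd n & m.-1.*2 <= n.-1] -> cntT m n = 0.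
Proof.
move=> H; apply: num_eq0 => c tc cT cn; move/negP: H; apply.
have [c0 cev] := tree_word_size tc; have um := size_undup_letters cT.
have : 1.*2 * (size (undup c)).-1 <= (size c).-1.
  by apply: size_letters => // e ec; rewrite -has_count has_pred1.
rewrite um cn -doubleMl mul1n => ->; rewrite andbT; apply/andP; split.
  by rewrite -um; case: (c) c0 => [|a s] // _; rewrite -has_predT; apply/hasP; exists a; rewrite ?mem_undup ?mem_head.
by rewrite -cn; case: (size c) c0 cev => //= k _; rewrite negbK.
Qed.

Lemma num_sub (T : finType) (P Q : pred (seq T)) A n :
  (forall c, P c -> Q c) -> num_words Q A n = 0 -> num_words P A n = 0.
Proof.
move=> PQ /eqP; rewrite size_eq0 => /eqP Q0; apply: num_eq0 => c /PQ Qc cA cn.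
by have := mem_words_on Q A n c; rewrite Q0 Qc cA cn !eqxx.
Qed.

Lemma cntH_eq0 i m n : ~~ [&& 0 < m, odd n & m.-1.*2 <= n.-1] -> cntH i m n = 0.
Proof. by move/cntT_eq0; apply: num_sub => c /and3P[]. Qed.

Lemma cntH_small i m n : n <= i -> cntH i m n = 0.
Proof. by move=> ni; apply: num_eq0 => c /and3P[_ + _] _ cn; rewrite cn ltnNge ni. Qed.

Lemma cntR_T m n : cntT m n = 0 -> cntR m n = 0.
Proof. by apply: num_sub => c /andP[]. Qed.

Lemma cntR_eq0 m n : n.-1 < 4 * m.-1 -> cntR m n = 0.
Proof.
move=> H; apply: num_eq0 => c /andP[tc us] cT cn; have um := size_undup_letters cT.
suff : 2.*2 * (size (undup c)).-1 <= (size c).-1 by rewrite um cn leqNgt H.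
apply: size_letters => // e ec.
have e0 : 0 < count_mem e (steps c) by rewrite -has_count has_pred1.
move: us; rewrite /unsimple -size_steps take_size => /allP /(_ e ec).
by case: (count_mem _ _) e0 => [|[]].
Qed.

(** * Reduced words on at most three letters *)

Section Small.
Definition neighbours (T : eqType) (c : seq T) x y := ((x, y) \in steps c) || ((y, x) \in steps c).
(* A form of [reduced_word] that computes, correct on at most three letters: an edge of such
   a graph fails to be a bridge only because of a triangle. *)
Definition reduced3 (T : eqType) (c : seq T) : bool :=
  [&& closed_word c, all (fun e => (e.1 != e.2) &&
      ~~ has (fun z => [&& z != e.1, z != e.2, neighbours c e.1 z & neighbours c z e.2]) c) (steps c) &
      all (fun e => count_mem e (steps c) != 1) (steps c)].

Lemma tree_word_card3 (T : finType) (c : seq T) : #|T| <= 3 -> reduced_word c = reduced3 c.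
Proof.
move=> T3; rewrite /reduced_word /tree_word /reduced3 -andbA; congr (_ && _).
rewrite /unsimple -size_steps take_size; congr (_ && _).
apply: eq_all => -[a b] /=; have [<-|ab] := eqVneq a b; first by rewrite connect0.
rewrite /=; congr (~~ _); apply/idP/hasP => [|[z zc /and4P[za zb az zb']]]; last first.
  apply: (@connect_trans _ _ z); apply: connect1; rewrite /edge_del.
    by rewrite -/(neighbours c a z) az !xpair_eqE (negbTE za) (negbTE zb) !andbF.
  by rewrite -/(neighbours c z b) zb' !xpair_eqE (negbTE za) (negbTE zb) !andbF.
move=> conn; have [/hasP //|/hasPn noz] := boolP (has
  (fun z => [&& z != a, z != b, neighbours c a z & neighbours c z b]) c).
(* The letter [a] with its neighbours other than [b]. If [a] and [b] have no common neighbour, no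
   edge but the deleted one leaves this set: a failure would take a fourth letter. *)
pose f v := (v == a) || (v != b) && neighbours c a v.
have wnbC x y : neighbours c x y = neighbours c y x by rewrite /neighbours orbC.
have fS u v : edge_del c (a, b) u v -> f u -> f v.
  move=> /and3P[]; rewrite -/(neighbours c u v) => uv n1 n2.
  case/orP=> [/eqP ua|/andP[ub au]].
    by apply/orP; right; rewrite -ua uv andbT; apply: contraNneq n1 => ->; rewrite ua.
  rewrite /f; have [//|va /=] := eqVneq v a.
  have [uE|uv'] := eqVneq u v; first by rewrite -uE ub au.
  have [ua|ua] := eqVneq u a.
    by rewrite -ua uv andbT; apply: contraNneq n1 => ->; rewrite ua.
  have uc : u \in c by case/orP: au => /mem_steps /andP[].
  have [vb|vb] /= := eqVneq v b.
    by have := noz u uc; rewrite ua ub au -vb uv.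
  have : uniq [:: a; b; u; v].
    by rewrite /= !inE !negb_or ab ![a == _]eq_sym ![b == _]eq_sym ua va ub vb uv'.
  by move/card_uniqP => E; have := leq_trans (max_card (mem [:: a; b; u; v])) T3; rewrite E.
have fE u v : edge_del c (a, b) u v -> f u = f v.
  by move=> uv; apply/idP/idP; apply: fS => //; rewrite edge_del_sym.
by have := connect_invariant fE conn; rewrite /f eqxx [b == a]eq_sym (negbTE ab) eqxx.
Qed.

Lemma reduced3_map (T T' : eqType) (f : T -> T') c : injective f -> reduced3 (map f c) = reduced3 c.
Proof.
move=> f_inj.
have wm x y : neighbours (map f c) (f x) (f y) = neighbours c x y.
  by rewrite /neighbours steps_map (mem_map (pair_map_inj f_inj) _ (x, y)) (mem_map (pair_map_inj f_inj) _ (y, x)).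
rewrite /reduced3 steps_map !all_map; congr [&& _, _ & _].
- by case: c {wm} => [|x s] //=; rewrite last_map (inj_eq f_inj).
- apply: eq_all => e /=; rewrite has_map (inj_eq f_inj); congr (_ && ~~ _).
  by apply: eq_has => z /=; rewrite !(inj_eq f_inj) !wm.
- apply: eq_all => e /=; rewrite count_map; congr (_ != 1).
  by apply: eq_count => e' /=; rewrite (inj_eq (pair_map_inj f_inj)).
Qed.

(** Natural numbers instead of ordinals, so that the enumeration evaluates by [vm_compute]. *)
Fixpoint nat_words m n : seq (seq nat) :=
  if n is n'.+1 then [seq x :: c | x <- iota 0 m, c <- nat_words m n'] else [:: [::]].

Lemma map_words m n : map (map val) (words 'I_m n) = nat_words m n.
Proof.
elim: n => [|n IH] //=; rewrite map_allpairs -IH -val_enum_ord allpairs_mapl allpairs_mapr.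
by [].
Qed.

Lemma cntR_compute m n : m <= 3 ->
  cntR m n = count (fun c => reduced3 c && all (mem c) (iota 0 m)) (nat_words m n).
Proof.
move=> m3; rewrite /cntR /cnt /num_words size_filter -map_words count_map; apply: eq_count => c /=.
rewrite tree_word_card3 ?card_ord // (reduced3_map _ val_inj); congr (_ && _).
rewrite -val_enum_ord all_map; apply/eqP/allP => [cT x _|H].
  by rewrite /= (mem_map val_inj); have := in_setT x; rewrite -cT inE.
apply/setP => x; rewrite !inE; have := H x; rewrite mem_enum => /(_ isT).
by rewrite /= (mem_map val_inj).
Qed.

(** Divided by the factorial of the number of letters, these counts are the coefficients 1, 1, 6 and
    1 of u q^2, u^2 q^3, u^2 q^4 and 1 in P. The 6 are walks on a path with two edges, each crossed
    twice in each direction: three start at the middle vertex and three at an end. *)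
Lemma cntR_2_5 : cntR 2 5 = 2. Proof. by rewrite cntR_compute //; vm_compute. Qed.
Lemma cntR_2_7 : cntR 2 7 = 2. Proof. by rewrite cntR_compute //; vm_compute. Qed.
Lemma cntR_3_9 : cntR 3 9 = 36. Proof. by rewrite cntR_compute //; vm_compute. Qed.
Lemma cntR_1_1 : cntR 1 1 = 1. Proof. by rewrite cntR_compute //; vm_compute. Qed.
Lemma cntT_1 n : cntT 1 n.+2 = 0.
Proof.
apply: num_eq0 => -[|x [|y c]] // tc _ _.
by have /negP[] := tree_word_neq tc (mem_head _ _); rewrite (ord1 x) (ord1 y).
Qed.
End Small.

(** * Tree walks as tree words *)

Section WalkGraph.
Variables (m L : nat).
Implicit Type v : {ffun 'I_L.+1 -> 'I_m}.

(** Repeating the first vertex makes the cyclic steps of the walk the steps of a word. The length is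
    [L.+1] in this section so that [v ord0] exists. *)
Definition closing v : seq 'I_m := rcons (codom v) (v ord0).

Lemma size_closing v : size (closing v) = L.+2.
Proof. by rewrite size_rcons size_codom card_ord. Qed.

Lemma nth_closing v x0 (j : 'I_L.+1) : nth x0 (closing v) j = v j.
Proof.
rewrite nth_rcons size_codom card_ord ltn_ord (nth_map j) ?size_enum_ord //.
by rewrite nth_ord_enum.
Qed.

Lemma nth_closingS v x0 (j : 'I_L.+1) : nth x0 (closing v) j.+1 = v (ordS j).
Proof.
have [jL|jL] := ltnP j L.
  have -> : j.+1 = ordS j by rewrite /= modn_small.
  exact: nth_closing.
have jE : j = L :> nat by apply/eqP; rewrite eqn_leq jL -ltnS ltn_ord.
rewrite nth_rcons size_codom card_ord jE ltnn eqxx; congr (v _).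
by apply/val_inj; rewrite /= jE modnn.
Qed.

Lemma steps_closing v : steps (closing v) = [seq (v j, v (ordS j)) | j : 'I_L.+1].
Proof.
have x0 := (v ord0, v ord0); apply: (@eq_from_nth _ x0).
  by rewrite size_steps size_closing size_map size_enum_ord.
rewrite size_steps size_closing /= => i iL; pose j := Ordinal iL.
rewrite (nth_map j) ?size_enum_ord // -[i]/(val j) nth_ord_enum.
case: x0 => a b; rewrite nth_zip_cond size_steps size_closing /= iL.
by rewrite nth_behead (nth_closing v a j) (nth_closingS v b j).
Qed.

Lemma closed_closing v : closed_word (closing v).
Proof.
have := size_closing v; case E: (closing v) => [|x s] //= _.
have := nth_closing v x ord0; rewrite E /= => xv.
by rewrite -[last x s]/(last x (x :: s)) -E last_rcons xv.
Qed.

Lemma walk_adjE v x y : walk_adj v x y =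
  (x != y) && (((x, y) \in steps (closing v)) || ((y, x) \in steps (closing v))).
Proof.
rewrite /walk_adj steps_closing; congr (_ && _).
apply/existsP/orP => [[j /orP[/andP[/eqP <- /eqP <-]|/andP[/eqP <- /eqP <-]]]|].
- by left; apply: image_f.
- by right; apply: image_f.
by case=> /mapP[j _ [-> ->]]; exists j; rewrite !eqxx ?orbT.
Qed.

Lemma connect_steps (T : finType) (c : seq T) (e : rel T) :
  (forall x y, (x, y) \in steps c -> e x y) -> forall y, y \in c -> connect e (head y c) y.
Proof.
case: c => [|z s] // + y; elim: s z => [|b s IH] z H /=.
  by rewrite inE => /eqP ->; exact: connect0.
rewrite in_cons => /orP[/eqP ->|ys]; first exact: connect0.
apply: (connect_trans (connect1 (H _ _ (mem_head _ _)))).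
by apply: IH => // x w xw; apply: H; rewrite steps_cons in_cons xw orbT.
Qed.

(** A graph is acyclic iff each edge is a bridge: a detour around an edge closes up to a cycle, and
    a cycle gives a detour around each of its edges. *)
Lemma is_tree_walkE v : is_tree_walk v = tree_word (closing v) && (letters (closing v) == setT).
Proof.
set c := closing v.
have mem_c x : (x \in c) = (x \in codom v).
  rewrite mem_rcons in_cons orb_idl // => /eqP ->; exact: codom_f.
have covE : [forall x : 'I_m, x \in codom v] = (letters c == setT).
  apply/forallP/eqP => [H|cT x]; first by apply/setP => x; rewrite in_setT inE mem_c; exact: H.
  by rewrite -mem_c; have := in_setT x; rewrite -cT inE.
have distE : [forall j : 'I_L.+1, v j != v (ordS j)] = all (fun e => e.1 != e.2) (steps c).
  rewrite steps_closing; apply/forallP/allP => [H e /mapP[j _ ->]|H j]; first exact: H.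
  by apply: (H (v j, v (ordS j))); exact: image_f.
rewrite /is_tree_walk covE distE -andbA [RHS]andbC.
have [cT|] := eqVneq (letters c); rewrite ?andFb // !andTb /tree_word closed_closing andTb.
have m_gt0 : 0 < m := leq_ltn_trans (leq0n _) (ltn_ord (v ord0)).
have adj_sym : symmetric (walk_adj v).
  by move=> x y; rewrite !walk_adjE eq_sym orbC.
have cT' x : x \in c by have := in_setT x; rewrite -cT inE.
apply/idP/idP => [/andP[/allP dist /andP[_ /forallP acyc]]|/allP H].
  apply/allP => -[a b] abc.
  apply/negP => /= /connectP[p0 + bE]; move=> p0w; case/shortenP: p0w bE => p pw up _ bE.
  have ab := dist _ abc; rewrite /= in ab.
  have p2 : 1 < size p.
    case: p pw bE {up} => [_ aE|z [|w p] //=]; first by rewrite aE eqxx in ab.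
    by rewrite andbT => /and3P[_ + _] bE; rewrite bE eqxx.
  have pm : size (a :: p) < m.+1.
    by rewrite ltnS -(card_uniqP up) -[X in _ <= X]card_ord max_card.
  have := acyc (Ordinal pm) => /forallP /(_ (in_tuple (a :: p))) /implyP /=.
  rewrite ltnS p2 => /(_ isT) /negP[]; rewrite -/(uniq (a :: p)) up andbT rcons_path.
  apply/andP; split; last by rewrite -bE adj_sym walk_adjE ab abc.
  apply: sub_path pw => x y /and3P[xy _ _]; rewrite walk_adjE xy andbT.
  by case/orP: xy => /dist //=; rewrite eq_sym.
have neq e : e \in steps c -> e.1 != e.2.
  by move=> /H; apply: contra => /eqP ->; exact: connect0.
apply/andP; split; first exact/allP.
apply/andP; split.
  rewrite m_gt0; apply/forallP => x; apply/forallP => y.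
  have ad a b : (a, b) \in steps c -> walk_adj v a b.
    by move=> ab; rewrite walk_adjE ab (neq _ ab).
  have hE z : z \in c -> head z c = v ord0.
    by have := nth_closing v z ord0; rewrite -/c; case: (c).
  apply: (@connect_trans _ _ (v ord0)).
    by rewrite (sym_connect_sym adj_sym) -(hE x) ?cT' //; apply: connect_steps.
  by rewrite -(hE y) ?cT' //; apply: connect_steps.
apply/forallP => k; apply/forallP => -[t tk]; apply/implyP => k3; apply/negP => /andP[]; rewrite [tval _]/=.
have : 3 <= size t by rewrite (eqP tk).
case: t {tk} => [|a [|b [|z p]]] // _; rewrite [cycle _ _]/= [uniq _]/=.
rewrite rcons_path !inE !negb_or => /and4P[ab bz zp la].
move=> /and4P[/and3P[anb az ap] /andP[bnz bp] znp up].
(* The graph without the first edge of the cycle, in which the rest of the cycle still joins [b] to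
   [a]. *)
pose r u w := [&& walk_adj v u w, (u, w) != (a, b) & (w, u) != (a, b)].
have conn : connect r b a.
  apply: (@connect_trans _ _ (last z p)); last first.
    apply: connect1; rewrite /r la !xpair_eqE [a == b](negbTE anb) andbF eqxx /=.
    have : last z p \in z :: p := mem_last z p.
    by apply: contraTneq => ->; rewrite inE negb_or bnz.
  apply/connectP; exists (z :: p) => //.
  apply: (@sub_in_path _ (predC1 a) (walk_adj v)); last by rewrite /= bz.
    move=> u w ua wa uw; rewrite /r uw !xpair_eqE /=.
    by move: ua wa; rewrite !inE => /negbTE -> /negbTE ->.
  rewrite /= eq_sym anb eq_sym az /=; apply/allP => w wp /=.
  by apply: contraNneq ap => <-.
have sub e : (e == (a, b)) || (e == (b, a)) -> subrel r (connect (edge_del c e)).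
  move=> eE u w /and3P[]; rewrite walk_adjE => /andP[_ uw] n1 n2; apply: connect1.
  have sw (x y : 'I_m) : ((x, y) == (b, a)) = ((y, x) == (a, b)) by rewrite !xpair_eqE andbC.
  by rewrite /edge_del uw; case/orP: eE => /eqP ->; rewrite ?sw n1 n2.
move: ab; rewrite walk_adjE anb => /orP[] /H /negP[] /=; last first.
  by apply: (connect_sub (sub (b, a) _)) conn; rewrite eqxx orbT.
rewrite edge_del_connect_sym.
by apply: (connect_sub (sub (a, b) _)) conn; rewrite eqxx.
Qed.

Lemma card_tree_walks : #|[set v : {ffun 'I_L.+1 -> 'I_m} | is_tree_walk v]| = cntT m L.+2.
Proof.
rewrite cardE -(size_map closing); apply/perm_size/uniq_perm.
- rewrite map_inj_uniq ?enum_uniq // => v1 v2 E; apply/ffunP => j.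
  by rewrite -(nth_closing v1 (v1 j) j) E nth_closing.
- exact: uniq_words_on.
move=> c; rewrite mem_words_on; apply/mapP/and3P => [[v + ->]|[tc cT /eqP cL]].
  by rewrite mem_enum inE is_tree_walkE size_closing => /andP[-> ->].
case: c tc cT cL => [|x s] // tc cT [sL].
pose v := [ffun j : 'I_L.+1 => nth x (x :: s) j].
have vE : closing v = x :: s.
  apply: (@eq_from_nth _ x); rewrite size_closing /= ?sL // => j jL.
  have [j1|j1] := ltnP j L.+1; first by rewrite (nth_closing v x (Ordinal j1)) ffunE.
  have -> : j = L.+1 by apply/eqP; rewrite eqn_leq j1 -ltnS jL.
  rewrite nth_rcons size_codom card_ord ltnn eqxx ffunE /=.
  by have := nth_last x s; rewrite sL /= => ->; case/andP: tc => /= /eqP ->.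
by exists v; rewrite ?vE // mem_enum inE is_tree_walkE vE tc cT.
Qed.
End WalkGraph.

Lemma w_cntT m l : w m l = cntT m (2 * l).+1.
Proof.
rewrite /w; have [->|m0] := eqVneq m 0; first by rewrite cntT_eq0.
have [->|m1] := eqVneq m 1.
  case: l => [|l]; last by rewrite mulnS !addSn cntT_1.
  rewrite /cntT /cnt /num_words size_filter /words.
  have -> : enum 'I_1 = [:: ord0].
    by apply: (@inj_map _ _ val val_inj); rewrite val_enum_ord.
  rewrite /= /tree_word /=; have -> : letters [:: ord0 : 'I_1] == setT; last by [].
  by apply/eqP/setP => x; rewrite !inE (ord1 x).
have m2 : 1 < m by case: (m) m0 m1 => [|[]].
case: l => [|l].
  rewrite muln0 cntT_eq0; last by case: (m) m2 => [|[]].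
  apply/eqP; rewrite cards_eq0 -subset0; apply/subsetP => v; rewrite inE => /andP[/andP[/forallP]].
  by move=> /(_ (Ordinal (ltnW m2))) /codomP[[]].
have -> : 2 * l.+1 = (2 * l).+1.+1 by lia.
exact: card_tree_walks.
Qed.

(** * Formal power series in z, and in z with polynomial coefficients in u *)

Local Open Scope ring_scope.

Record fps (R : Type) := Fps { fcoef :> nat -> R }.
HB.instance Definition _ (R : Type) := gen_eqMixin (fps R).
HB.instance Definition _ (R : Type) := gen_choiceMixin (fps R).

Lemma fpsP (R : Type) (f g : fps R) : (forall n, f n = g n) -> f = g.
Proof. by case: f g => [f] [g] /= fg; congr Fps; apply/funext. Qed.

Section FpsRing.
Variable R : comNzRingType.
Implicit Types f g h : fps R.

Definition fzero : fps R := Fps (fun=> 0).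
Definition fone : fps R := Fps (fun n => (n == 0%N)%:R).
Definition fadd f g : fps R := Fps (fun n => f n + g n).
Definition fopp f : fps R := Fps (fun n => - f n).
Definition fmul f g : fps R := Fps (fun n => \sum_(k < n.+1) f k * g (n - k)%N).

Fact faddA : associative fadd.
Proof. by move=> f g h; apply: fpsP => n /=; rewrite addrA. Qed.
Fact faddC : commutative fadd.
Proof. by move=> f g; apply: fpsP => n /=; rewrite addrC. Qed.
Fact fadd0 : left_id fzero fadd.
Proof. by move=> f; apply: fpsP => n /=; rewrite add0r. Qed.
Fact faddN : left_inverse fzero fopp fadd.
Proof. by move=> f; apply: fpsP => n /=; rewrite addNr. Qed.
HB.instance Definition _ := GRing.isZmodule.Build (fps R) faddA faddC fadd0 faddN.

Definition trunc n f : {poly R} := \poly_(i < n.+1) f i.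

(** Lets commutativity and associativity be inherited from polynomials. *)
Lemma fmul_trunc n m f g : (m <= n)%N -> fmul f g m = (trunc n f * trunc n g)`_m.
Proof.
move=> mn; rewrite coefM /=; apply: eq_bigr => k _.
by rewrite !coef_poly !ltnS (leq_trans (leq_subr _ _) mn) (leq_trans _ mn) // -ltnS.
Qed.

Fact fmulC : commutative fmul.
Proof. by move=> f g; apply: fpsP => n; rewrite !(@fmul_trunc n) // mulrC. Qed.
Fact fmul1 : left_id fone fmul.
Proof.
move=> f; apply: fpsP => n /=; rewrite big_ord_recl /= mul1r subn0 big1 ?addr0 //.
by move=> i _; rewrite mul0r.
Qed.
Fact fmulD : left_distributive fmul fadd.
Proof.
move=> f g h; apply: fpsP => n /=; rewrite -big_split /=.
by apply: eq_bigr => i _; rewrite mulrDl.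
Qed.
Fact fmulA : associative fmul.
Proof.
move=> f g h; apply: fpsP => n; rewrite !(@fmul_trunc n) //.
have aux a b c : (trunc n (fmul a b) * c)`_n = (trunc n a * trunc n b * c)`_n.
  rewrite !coefM; apply: eq_bigr => -[k kn] _ /=; rewrite coef_poly kn.
  by rewrite (@fmul_trunc n) // -ltnS.
by rewrite [in LHS]mulrC (aux g h) (aux f g) mulrC mulrA.
Qed.
Fact fone_neq0 : fone != fzero.
Proof. by apply/eqP => /(congr1 (fun f : fps R => f 0%N)) /eqP; rewrite /= oner_eq0. Qed.
HB.instance Definition _ := GRing.Zmodule_isComNzRing.Build (fps R)
  fmulA fmulC fmul1 fmulD fone_neq0.

Lemma fcoefD f g n : (f + g) n = f n + g n. Proof. by []. Qed.
Lemma fcoefN f n : (- f) n = - f n. Proof. by []. Qed.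
Lemma fcoefM f g n : (f * g) n = \sum_(k < n.+1) f k * g (n - k)%N. Proof. by []. Qed.
Lemma fcoef1 n : (1 : fps R) n = (n == 0%N)%:R. Proof. by []. Qed.
Lemma fcoef_sum I r (P : pred I) (F : I -> fps R) n :
  (\sum_(i <- r | P i) F i) n = \sum_(i <- r | P i) F i n.
Proof. by elim/big_rec2: _ => // i a b _ <-. Qed.

Definition fX : fps R := Fps (fun n => (n == 1%N)%:R).
Definition fC (a : R) : fps R := Fps (fun n => if n == 0%N then a else 0).

Lemma fcoefXM f n : (fX * f) n = if n is n'.+1 then f n' else 0.
Proof.
rewrite fcoefM; case: n => [|n]; first by rewrite big_ord1 /= mul0r.
rewrite big_ord_recl /= mul0r add0r big_ord_recl /= mul1r subn1 big1 ?addr0 //.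
by move=> i _; rewrite mul0r.
Qed.

Lemma fcoefCM a f n : (fC a * f) n = a * f n.
Proof.
rewrite fcoefM big_ord_recl /= subn0 big1 ?addr0 // => i _; by rewrite mul0r.
Qed.

Fact fC_zmod : zmod_morphism fC.
Proof. by move=> a b; apply: fpsP => -[|n]; rewrite fcoefD fcoefN //= subr0. Qed.
Fact fC_monoid : monoid_morphism fC.
Proof.
split; first by apply: fpsP => -[|n].
by move=> a b; apply: fpsP => -[|n]; rewrite fcoefCM //= mulr0.
Qed.
HB.instance Definition _ := GRing.isZmodMorphism.Build R (fps R) fC fC_zmod.
HB.instance Definition _ := GRing.isMonoidMorphism.Build R (fps R) fC fC_monoid.

Lemma fcoefXn k n : (fX ^+ k) n = (n == k)%:R.
Proof.
elim: k n => [|k IH] n //; rewrite exprS fcoefXM; by case: n.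
Qed.

Lemma fcoef_exp_small f : f 0%N = 0 -> forall k n, (n < k)%N -> (f ^+ k) n = 0.
Proof.
move=> f0; elim=> [|k IH] n nk //; rewrite exprS fcoefM big_ord_recl f0 mul0r add0r.
by rewrite big1 // => i _; rewrite IH ?mulr0 // lift0; have := ltn_ord i; lia.
Qed.

(** The geometric series for 1 / (1 - f). Stopping at [k = n] is exact when [f] has no constant
    term. *)
Definition finv1 f : fps R := Fps (fun n => \sum_(k < n.+1) (f ^+ k) n).

Lemma finv1_bound f : f 0%N = 0 -> forall N n, (n <= N)%N ->
  finv1 f n = \sum_(k < N.+1) (f ^+ k) n.
Proof.
move=> f0 N n nN /=; rewrite -!(big_mkord xpredT (fun k => (f ^+ k) n)).
rewrite [RHS](@big_cat_nat _ _ _ n.+1) //= [X in _ = _ + X]big_nat_cond.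
by rewrite [X in _ = _ + X]big1 ?addr0 // => k /andP[/andP[nk _] _]; exact: fcoef_exp_small.
Qed.

Lemma finv1P f : f 0%N = 0 -> (1 - f) * finv1 f = 1.
Proof.
move=> f0; apply: fpsP => n; rewrite mulrBl mul1r fcoefD fcoefN fcoefM.
have -> : \sum_(k < n.+1) f k * finv1 f (n - k)%N = \sum_(k < n.+1) (f ^+ k.+1) n.
  under eq_bigr do rewrite (finv1_bound f0 (leq_subr _ n)) mulr_sumr.
  by rewrite exchange_big /=; apply: eq_bigr => k _; rewrite exprS fcoefM.
rewrite /= big_ord_recl expr0 big_ord_recr /= fcoef_exp_small // addr0.
by rewrite addrK.
Qed.
End FpsRing.
Arguments fX {R}.
Arguments fC {R}.

Notation qz := (fps rat).
Notation qzu := (fps {poly rat}).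

Section CoefU.
Implicit Types f g : qzu.
Definition coefu j f : qz := Fps (fun n => (f n)`_j).
Definition embed (f : qz) : qzu := Fps (fun n => (f n)%:P).
Definition fu : qzu := fC 'X.

Fact coefu_zmod j : zmod_morphism (coefu j).
Proof. by move=> f g; apply: fpsP => n; rewrite /= coefB. Qed.
HB.instance Definition _ j := GRing.isZmodMorphism.Build qzu qz (coefu j) (coefu_zmod j).

Lemma coefuM j f g :
  coefu j (f * g) = \sum_(i < j.+1) coefu i f * coefu (j - i) g.
Proof.
apply: fpsP => n; rewrite fcoef_sum.
transitivity (\sum_(k < n.+1) (f k * g (n - k)%N)`_j); first by rewrite -coef_sum.
under eq_bigr do rewrite coefM.
by rewrite exchange_big.
Qed.

Fact embed_zmod : zmod_morphism embed.
Proof. by move=> f g; apply: fpsP => n; rewrite /= polyCB. Qed.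
Fact embed_monoid : monoid_morphism embed.
Proof.
split; first by apply: fpsP => n /=; case: (n == 0%N); rewrite ?polyC1 ?polyC0.
move=> f g; apply: fpsP => n; rewrite /= rmorph_sum /=.
by apply: eq_bigr => i _; rewrite polyCM.
Qed.
HB.instance Definition _ := GRing.isZmodMorphism.Build qz qzu embed embed_zmod.
HB.instance Definition _ := GRing.isMonoidMorphism.Build qz qzu embed embed_monoid.

Lemma coefu_embed j (a : qz) : coefu j (embed a) = if j == 0%N then a else 0.
Proof. by apply: fpsP => n /=; rewrite coefC; case: ifP. Qed.

Lemma coefu1 j : coefu j 1 = if j == 0%N then 1 else 0.
Proof. by rewrite -[1 in LHS](rmorph1 embed) coefu_embed. Qed.

Lemma coefu_embedM j (a : qz) f : coefu j (embed a * f) = a * coefu j f.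
Proof.
rewrite coefuM big_ord_recl coefu_embed subn0 big1 ?addr0 // => i _.
by rewrite coefu_embed mul0r.
Qed.

Lemma coefu_fuM j f : coefu j (fu * f) = if j is j'.+1 then coefu j' f else 0.
Proof.
apply: fpsP => n; transitivity ((fu * f) n)`_j => //.
by rewrite fcoefCM coefXM; case: j.
Qed.

Lemma coefu_fC j (a : {poly rat}) : coefu j (fC a) = fC a`_j.
Proof. by apply: fpsP => -[|n] //=; rewrite coef0. Qed.

Lemma coefuM_small N f g : (forall j, (j <= N)%N -> coefu j g = 0) ->
  forall j, (j <= N)%N -> coefu j (f * g) = 0.
Proof.
move=> g0 j jN; rewrite coefuM big1 // => i _.
by rewrite g0 ?mulr0 // (leq_trans (leq_subr _ _)).
Qed.
End CoefU.

Lemma fps_mulI_unit (R : comNzRingType) (f g : fps R) : g 0%N = 1 -> f * g = 0 -> f = 0.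
Proof.
move=> g1 fg; have h0 : (1 - g) 0%N = 0 by rewrite fcoefD fcoefN g1 /= subrr.
have := finv1P h0; have -> : 1 - (1 - g) = g by ring.
by move=> gi; rewrite -[f]mulr1 -gi mulrA fg mul0r.
Qed.

(** * Polynomials in x and a filtration by pole order *)

Section PolyIn.
Variable x : qz.
Definition polyin (f : qz) := exists Q : {poly rat}, f = (map_poly fC Q).[x].

Lemma polyin_add f g : polyin f -> polyin g -> polyin (f + g).
Proof. by move=> [P ->] [Q ->]; exists (P + Q); rewrite rmorphD hornerD. Qed.
Lemma polyin_mul f g : polyin f -> polyin g -> polyin (f * g).
Proof. by move=> [P ->] [Q ->]; exists (P * Q); rewrite rmorphM hornerM. Qed.
Lemma polyin_C a : polyin (fC a).
Proof. by exists a%:P; rewrite map_polyC hornerC. Qed.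
Lemma polyin_x : polyin x.
Proof. by exists 'X; rewrite map_polyX hornerX. Qed.
Lemma polyin_0 : polyin 0. Proof. by rewrite -(rmorph0 (@fC rat)); exact: polyin_C. Qed.
Lemma polyin_1 : polyin 1. Proof. by rewrite -(rmorph1 (@fC rat)); exact: polyin_C. Qed.
Lemma polyin_opp f : polyin f -> polyin (- f).
Proof. by move=> [P ->]; exists (- P); rewrite rmorphN hornerN. Qed.
Lemma polyin_exp f n : polyin f -> polyin (f ^+ n).
Proof.
by move=> pf; elim: n => [|n IH]; [exact: polyin_1 | rewrite exprS; exact: polyin_mul].
Qed.
Lemma polyin_muln f n : polyin f -> polyin (f *+ n).
Proof.
by move=> pf; elim: n => [|n IH]; [exact: polyin_0 | rewrite mulrS; exact: polyin_add].
Qed.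
Lemma polyin_sum n (F : 'I_n -> qz) : (forall i, polyin (F i)) -> polyin (\sum_i F i).
Proof. move=> h; elim/big_rec: _ => [|i f _ pf]; [exact: polyin_0 | exact: polyin_add]. Qed.

(* [f] lies in the ideal (1 - x)^k of the ring of series whose u^j-coefficient is a
   polynomial in x over (1 - x)^j, up to order u^n. *)
Definition filt n k (f : qzu) := forall j, (j <= n)%N ->
  exists2 g, polyin g & (1 - x) ^+ j * coefu j f = (1 - x) ^+ k * g.

Lemma filt_add n k f g : filt n k f -> filt n k g -> filt n k (f + g).
Proof.
move=> hf hg j jn; have [a pa ea] := hf j jn; have [b pb eb] := hg j jn.
by exists (a + b); [exact: polyin_add | rewrite raddfD mulrDr ea eb mulrDr].
Qed.

Lemma filt_opp n k f : filt n k f -> filt n k (- f).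
Proof.
move=> hf j jn; have [a pa ea] := hf j jn.
by exists (- a); [exact: polyin_opp | rewrite raddfN mulrN ea mulrN].
Qed.

Lemma filt_mul n k l f g : filt n k f -> filt n l g -> filt n (k + l) (f * g).
Proof.
move=> hf hg j jn.
have H (i : 'I_j.+1) : exists h, polyin h /\
    (1 - x) ^+ j * (coefu i f * coefu (j - i) g) = (1 - x) ^+ (k + l) * h.
  have ij : (i <= j)%N by rewrite -ltnS.
  have [a pa ea] := hf i (leq_trans ij jn).
  have [b pb eb] := hg (j - i)%N (leq_trans (leq_subr _ _) jn).
  exists (a * b); split; first exact: polyin_mul.
  by rewrite -{1}(subnKC ij) !exprD mulrACA ea eb mulrACA.
have [F hF] := choice H; exists (\sum_i F i).
  by apply: polyin_sum => i; case: (hF i).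
by rewrite coefuM !mulr_sumr; apply: eq_bigr => i _; case: (hF i).
Qed.

Lemma filt_weaken n k f : filt n k.+1 f -> filt n k f.
Proof.
move=> hf j jn; have [a pa ea] := hf j jn; exists ((1 - x) * a); last by rewrite ea exprS; ring.
by apply: polyin_mul => //; apply: polyin_add polyin_1 (polyin_opp polyin_x).
Qed.

Lemma filt_embed n k g : polyin g -> filt n k (embed ((1 - x) ^+ k * g)).
Proof.
move=> pg [|j] jn; rewrite coefu_embed /=.
  by exists g => //; rewrite expr0 mul1r.
by exists 0; [exact: polyin_0 | rewrite !mulr0].
Qed.

Lemma filt_embed0 n g : polyin g -> filt n 0 (embed g).
Proof. by move=> /(@filt_embed n 0); rewrite expr0 mul1r. Qed.

Lemma filt_exp n f m : filt n 0 f -> filt n 0 (f ^+ m).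
Proof.
move=> hf; elim: m => [|m IH]; last by rewrite exprS; exact: (filt_mul hf IH).
by rewrite expr0 -(rmorph1 embed); apply: filt_embed0; exact: polyin_1.
Qed.

(** The weight 1 - x attached to each order of u makes u itself count as one power of the ideal. *)
Lemma filt_fuM n k f : filt n k f -> filt n.+1 k.+1 (fu * f).
Proof.
move=> hf [|j] jn; rewrite coefu_fuM.
  by exists 0; [exact: polyin_0 | rewrite !mulr0].
have [a pa ea] := hf j jn; exists a => //.
by rewrite !exprS -!mulrA ea.
Qed.

(** Without terms of order u^0, the coefficient of u^(n+1) in a product uses the factors only up to
    u^n. This gains the order needed for the induction on [n]. *)
Lemma filt_mul0 n k l f g : coefu 0 f = 0 -> coefu 0 g = 0 ->
  filt n k f -> filt n l g -> filt n.+1 (k + l) (f * g).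
Proof.
move=> f0 g0 hf hg j jn.
have H (i : 'I_j.+1) : exists h, polyin h /\
    (1 - x) ^+ j * (coefu i f * coefu (j - i) g) = (1 - x) ^+ (k + l) * h.
  have ij : (i <= j)%N by rewrite -ltnS.
  have [i0|i0] := posnP i.
    by exists 0; split; [exact: polyin_0 | rewrite i0 f0 mul0r !mulr0].
  have [ij0|ij0] := posnP (j - i).
    by exists 0; split; [exact: polyin_0 | rewrite ij0 g0 !mulr0].
  have [|a pa ea] := hf i; first by lia.
  have [|b pb eb] := hg (j - i)%N; first by lia.
  exists (a * b); split; first exact: polyin_mul.
  by rewrite -{1}(subnKC ij) !exprD mulrACA ea eb mulrACA.
have [F hF] := choice H; exists (\sum_i F i).
  by apply: polyin_sum => i; case: (hF i).
by rewrite coefuM !mulr_sumr; apply: eq_bigr => i _; case: (hF i).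
Qed.

Lemma filt_small n k f : (forall j, (j <= n)%N -> coefu j f = 0) -> filt n k f.
Proof. by move=> f0 j jn; exists 0; [exact: polyin_0 | rewrite f0 // !mulr0]. Qed.

Lemma filt_sum n k m (F : 'I_m -> qzu) : (forall i, filt n k (F i)) -> filt n k (\sum_i F i).
Proof.
move=> h; elim/big_rec: _ => [|i f _ pf]; last exact: filt_add.
by apply: filt_small => j _; rewrite raddf0.
Qed.

Lemma filt_fC n a : filt n 0 (fC a).
Proof.
move=> j jn; rewrite coefu_fC; exists ((1 - x) ^+ j * fC a`_j); last by rewrite expr0 mul1r.
apply: polyin_mul (polyin_C _); apply: polyin_exp.
exact: polyin_add polyin_1 (polyin_opp polyin_x).
Qed.
End PolyIn.

(** * Solving the functional equation around the Catalan series *)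

Section Tree.
Variables (M Y : qzu) (C x : qz).
Let z' : qzu := embed fX * (1 - fu).
Let q : qzu := z' * Y ^+ 2.
Hypothesis YM : (1 - z' * M) * Y = 1.
Hypothesis x_eq : x = fX * C ^+ 2.
Hypothesis C_eq : C = 1 + x.
(** P is polynomial in q at each order of u but need not be so as a whole, hence a finite sum with a
    remainder vanishing through u^N. *)
Hypothesis M_eq : forall N, exists L (a : nat -> {poly rat}) (R : qzu),
  (forall j, (j <= N)%N -> coefu j R = 0) /\
  M = Y * (1 + fu * q ^+ 2 + fu ^+ 2 * (q ^+ 3 + q ^+ 4 *+ 6
           + fu * \sum_(l < L) fC (a l) * q ^+ l) + R).

(** Division-free forms of Y / C - 1 and, for [P], of M / Y: the inverse of C is 1 - z C, and that
    of Y is [1 - z' * M]. *)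
Let e : qzu := Y * (1 - embed (fX * C)) - 1.
Let P : qzu := M * (1 - z' * M).

Let x0 : x 0%N = 0. Proof. by rewrite x_eq fcoefXM. Qed.
Let one_sub_x0 : (1 - x) 0%N = 1. Proof. by rewrite fcoefD fcoefN x0 subr0. Qed.

Let CK : (1 - fX * C) * C = 1.
Proof. by have -> : (1 - fX * C) * C = C - x by [rewrite x_eq; ring]; rewrite {1}C_eq addrK. Qed.

Let Y_e : Y = embed C * (1 + e).
Proof.
have := congr1 embed CK; rewrite rmorphM rmorphB !rmorph1 => H.
have -> : embed C * (1 + e) = Y * ((1 - embed (fX * C)) * embed C) by rewrite /e; ring.
by rewrite H mulr1.
Qed.

Let q_e : q = (1 - fu) * embed x * (1 + e) ^+ 2.
Proof. by rewrite /q /z' Y_e x_eq rmorphM rmorphXn /=; ring. Qed.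

Let P_eq N : exists L (a : nat -> {poly rat}) (R : qzu),
  (forall j, (j <= N)%N -> coefu j R = 0) /\
  P = 1 + fu * q ^+ 2 + fu ^+ 2 * (q ^+ 3 + q ^+ 4 *+ 6
           + fu * \sum_(l < L) fC (a l) * q ^+ l) + R.
Proof.
have [L [a [R [R0 ME]]]] := M_eq N; exists L, a, R; split => //.
have -> : P = (1 - z' * M) * M by rewrite mulrC.
by rewrite {2}ME mulrA YM mul1r.
Qed.

Let M_P : M = Y * P.
Proof. by rewrite /P mulrCA [Y * _]mulrC YM mulr1. Qed.

(** From Y = 1 + q P. Moving the linear part 2xe of x (1 + e)^2 to the left leaves the coefficient 1
    + x - 2x of e. *)
Let e_eq : embed (1 - x) * e =
  embed x * ((1 - fu) * (1 + e) ^+ 2 * P - 1 - e *+ 2).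
Proof.
have H : Y = 1 + q * P.
  have -> : q * P = z' * Y * M by rewrite M_P /q; ring.
  have -> : z' * Y * M = Y - (1 - z' * M) * Y by ring.
  by rewrite YM addrC subrK.
have HC : embed C = 1 + embed x by rewrite {1}C_eq rmorphD rmorph1.
move: H; rewrite {1}Y_e q_e HC => H; rewrite rmorphB rmorph1.
have -> : (1 - embed x) * e = (1 + embed x) * (1 + e) - 1 - embed x - embed x * e *+ 2 by ring.
by rewrite H; ring.
Qed.

Let bracket (S R : qzu) : P = 1 + fu * q ^+ 2 + fu ^+ 2 * S + R ->
  (1 - fu) * (1 + e) ^+ 2 * P - 1 - e *+ 2 = e * e
    + fu * ((1 + e) ^+ 2 * (q ^+ 2 - 1 + fu * (S - q ^+ 2 - fu * S)))
    + (1 - fu) * (1 + e) ^+ 2 * R.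
Proof. by move=> ->; ring. Qed.

Let e0 : coefu 0 e = 0.
Proof.
have [L [a [R [R0 PE]]]] := P_eq 0.
have := congr1 (coefu 0) e_eq; have := bracket; clearbody e => br.
rewrite (br _ _ PE) !coefu_embedM !raddfD /=.
rewrite coefu_fuM (coefuM_small _ R0) // !addr0.
rewrite coefuM big_ord1 subnn => H.
(* At u = 0 the equation reads (1 - x) e = x e^2, and the cofactor of e is a unit. *)
apply: (@fps_mulI_unit _ _ (1 - x - x * coefu 0 e)).
  by rewrite fcoefD fcoefN one_sub_x0 fcoefM big_ord1 x0 mul0r subr0.
by rewrite mulrBr [_ * (1 - x)]mulrC H; ring.
Qed.

Let filt1 n : filt x n 0 1.
Proof. by rewrite -(rmorph1 embed); apply: filt_embed0; exact: polyin_1. Qed.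

Let filt_e n : filt x n 1 e.
Proof.
elim: n => [|n IH].
  by apply: filt_small => j; rewrite leqn0 => /eqP ->; exact: e0.
have [L [a [R [R0 PE]]]] := P_eq n.+1.
have fe0 : filt x n 0 e := filt_weaken IH.
have f1e : filt x n 0 ((1 + e) ^+ 2) by apply: filt_exp; exact: filt_add.
have fu1 : filt x n 1 fu.
  case: n {IH R0 PE fe0 f1e} => [|n].
    apply: filt_small => j; rewrite leqn0 => /eqP ->.
    by rewrite -[fu]mulr1 coefu_fuM.
  by rewrite -[fu]mulr1; apply: filt_fuM; exact: filt1.
have fu0 : filt x n 0 fu := filt_weaken fu1.
have fx : filt x n 0 (embed x) by apply: filt_embed0; exact: polyin_x.
have fq : filt x n 0 q.
  rewrite q_e; apply: (@filt_mul _ _ 0 0) => //; apply: (@filt_mul _ _ 0 0) => //.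
  by apply: filt_add => //; exact: filt_opp.
set S := q ^+ 3 + _ + _ in PE.
have fS : filt x n 0 S.
  apply: filt_add; last first.
    apply: (@filt_mul _ _ 0 0) => //; apply: filt_sum => i.
    by apply: (@filt_mul _ _ 0 0); [exact: filt_fC | exact: filt_exp].
  apply: filt_add; first exact: filt_exp.
  have -> : q ^+ 4 *+ 6 = embed 6%:R * q ^+ 4 by rewrite rmorph_nat mulr_natl.
  apply: (@filt_mul _ _ 0 0); last exact: filt_exp.
  by apply: filt_embed0; apply: polyin_muln; exact: polyin_1.
(* The decisive cancellation: q is x modulo u and e, and 1 - x divides x^2 - 1. The -1 comes from
   the factor 1 - u. *)
have fq1 : filt x n 1 (q ^+ 2 - 1).
  have -> : q ^+ 2 - 1 = embed ((1 - x) ^+ 1 * - (1 + x)) +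
      embed x * (q + embed x) * (e *+ 2 + e ^+ 2 - fu * (1 + e) ^+ 2).
    rewrite !(rmorphM, rmorphXn, rmorphN, rmorphD, rmorph1) q_e /=; ring.
  apply: filt_add.
    apply: filt_embed; apply: polyin_opp; apply: polyin_add (polyin_1 x) (polyin_x x).
  apply: (@filt_mul _ _ 0 1).
    by apply: (@filt_mul _ _ 0 0) => //; exact: filt_add.
  apply: filt_add; first apply: filt_add.
  - by rewrite mulr2n; exact: filt_add.
  - by rewrite expr2; apply: (@filt_mul _ _ 0 1).
  - by apply: filt_opp; apply: (@filt_mul _ _ 1 0).
(* Level 2 here is level 1 for e after cancelling 1 - x. *)
have : filt x n.+1 2 (embed (1 - x) * e).
  rewrite e_eq (bracket PE); apply: (@filt_mul _ _ 0 2).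
    by apply: filt_embed0; exact: polyin_x.
  apply: filt_add; first apply: filt_add.
  - exact: (filt_mul0 e0 e0 IH IH).
  - apply: filt_fuM; apply: (@filt_mul _ _ 0 1) => //; apply: filt_add => //.
    apply: (@filt_mul _ _ 1 0) => //; apply: filt_add.
      by apply: filt_add => //; apply: filt_opp; exact: filt_exp.
    by apply: filt_opp; apply: (@filt_mul _ _ 0 0).
  - by apply: filt_small => j jn; exact: (coefuM_small _ R0).
move=> H j jn; have [g pg] := H j jn; rewrite coefu_embedM => eg; exists g => //.
apply/subr0_eq; apply: (@fps_mulI_unit _ _ (1 - x)) => //.
transitivity ((1 - x) ^+ j * ((1 - x) * coefu j e) - (1 - x) ^+ 2 * g); first by ring.
by rewrite eg subrr.
Qed.

Lemma coefuM_pole i : exists2 g, polyin x g & (1 - x) ^+ i * coefu i M = C * g.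
Proof.
have [L [a [R [R0 PE]]]] := P_eq i.
have fe0 : filt x i 0 e := filt_weaken (@filt_e i).
have ffu : filt x i 0 fu by exact: filt_fC.
have f1e : filt x i 0 (1 + e) by apply: filt_add => //; exact: filt1.
have fx : filt x i 0 (embed x) by apply: filt_embed0; exact: polyin_x.
have fq : filt x i 0 q.
  rewrite q_e; apply: (@filt_mul _ _ 0 0); last exact: filt_exp.
  apply: (@filt_mul _ _ 0 0) => //.
  by apply: filt_add; [exact: filt1 | exact: filt_opp].
have fP : filt x i 0 P.
  rewrite PE; apply: filt_add; last exact: filt_small.
  apply: filt_add; first apply: filt_add; first exact: filt1.
    by apply: (@filt_mul _ _ 0 0) => //; exact: filt_exp.
  apply: (@filt_mul _ _ 0 0) => //; first exact: filt_exp.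
  apply: filt_add; last first.
    apply: (@filt_mul _ _ 0 0) => //; apply: filt_sum => k.
    by apply: (@filt_mul _ _ 0 0); [exact: filt_fC | exact: filt_exp].
  apply: filt_add; first exact: filt_exp.
  have -> : q ^+ 4 *+ 6 = embed 6%:R * q ^+ 4 by rewrite rmorph_nat mulr_natl.
  apply: (@filt_mul _ _ 0 0); last exact: filt_exp.
  by apply: filt_embed0; apply: polyin_muln; exact: polyin_1.
have [g pg eg] := filt_mul f1e fP (leqnn i).
exists g => //; rewrite M_P Y_e -mulrA coefu_embedM mulrCA eg.
by rewrite expr0 mul1r.
Qed.

(** The filtration still admits a simple pole of [u^2]e. Its numerator vanishes at x = 1 because the
    u^2-coefficients 1 and 6 of P add up to 7. *)
Lemma coefuM_regular i : (i <= 2)%N -> exists2 g, polyin x g & coefu i M = C * g.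
Proof.
clearbody z' q e P.
have [L [a [R [R0 PE]]]] := P_eq 2.
have cD j f g : coefu j (f + g) = coefu j f + coefu j g by rewrite raddfD.
have cN j f : coefu j (- f) = - coefu j f by rewrite raddfN.
have cMn j f n : coefu j (f *+ n) = coefu j f *+ n by rewrite raddfMn.
have cu0 f : coefu 0 (fu * f) = 0 by rewrite coefu_fuM.
have cu1 f : coefu 1 (fu * f) = coefu 0 f by rewrite coefu_fuM.
have cu2 f : coefu 2 (fu * f) = coefu 1 f by rewrite coefu_fuM.
have m0 f g : coefu 0 (f * g) = coefu 0 f * coefu 0 g by rewrite coefuM big_ord1.
have m1 f g : coefu 1 (f * g) = coefu 0 f * coefu 1 g + coefu 1 f * coefu 0 g.
  by rewrite coefuM !big_ord_recl big_ord0 /= addr0.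
have m2 f g : coefu 2 (f * g) = coefu 0 f * coefu 2 g + coefu 1 f * coefu 1 g + coefu 2 f * coefu 0 g.
  by rewrite coefuM !big_ord_recl big_ord0 /= addr0 addrA.
have c01 : coefu 0 1 = 1 by rewrite coefu1.
have c11 : coefu 1 1 = 0 by rewrite coefu1.
have c21 : coefu 2 1 = 0 by rewrite coefu1.
have x0' : coefu 0 (embed x) = x by rewrite coefu_embed.
have x1' : coefu 1 (embed x) = 0 by rewrite coefu_embed.
have x2' : coefu 2 (embed x) = 0 by rewrite coefu_embed.
have v0 : coefu 0 fu = 0 by rewrite -[fu]mulr1 coefu_fuM.
have v1 : coefu 1 fu = 1 by rewrite -[fu]mulr1 coefu_fuM.
have v2 : coefu 2 fu = 0 by rewrite -[fu]mulr1 coefu_fuM coefu1.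
have R0' := R0 0%N isT; have R1' := R0 1%N isT; have R2' := R0 2%N isT.
have q0 : coefu 0 q = x.
  by rewrite q_e !(expr2, m0, cD, cN, c01, x0', v0, e0) /=; ring.
have q1 : coefu 1 q = x * (coefu 1 e *+ 2 - 1).
  rewrite q_e !(expr2, m1, m0, cD, cN, c01, x0', v0, e0, c11, x1', v1) /=; ring.
set e1 := coefu 1 e in q1.
set S := q ^+ 3 + _ + _ in PE.
have S0 : coefu 0 S = x ^+ 3 + x ^+ 4 *+ 6.
  by rewrite /S !(cD, cMn) /= cu0 !exprS !expr0 !mulr1 !m0 q0 addr0.
have e1_eq : e1 = - (x * (1 + x)).
  have H : (1 - x) * e1 = x * (x ^+ 2 - 1).
    have := congr1 (coefu 1) e_eq; rewrite (bracket PE) !coefu_embedM -/e1 => ->.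
    congr (x * _); rewrite !cD /= cu1 (coefuM_small _ R0) //.
    by rewrite !(expr2, m1, m0, cD, cN, c01, v0, e0, q0) /=; ring.
  apply/subr0_eq; apply: (@fps_mulI_unit _ _ (1 - x)) => //.
  transitivity ((1 - x) * e1 - x * (x ^+ 2 - 1)); first by ring.
  by rewrite H subrr.
have e2_eq : coefu 2 e = x * (x *+ 2 + x ^+ 2 *+ 2 - x ^+ 3).
  have H : (1 - x) * coefu 2 e = x * ((1 - x) * (x *+ 2 + x ^+ 2 *+ 2 - x ^+ 3)).
    have := congr1 (coefu 2) e_eq; rewrite (bracket PE) !coefu_embedM => ->.
    congr (x * _); rewrite !cD /= cu2 (coefuM_small _ R0) //.
    rewrite !(expr2, m2, m1, m0, cD, cN, c01, c11, v0, v1, e0, q0, q1, S0) /=.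
    by rewrite -/e1 e1_eq; ring.
  apply/subr0_eq; apply: (@fps_mulI_unit _ _ (1 - x)) => //.
  transitivity ((1 - x) * coefu 2 e - x * ((1 - x) * (x *+ 2 + x ^+ 2 *+ 2 - x ^+ 3))).
    by ring.
  by rewrite H subrr.
have P0 : coefu 0 P = 1.
  by rewrite PE !(expr2, m0, cD, c01, v0, R0') /=; ring.
have P1 : coefu 1 P = x ^+ 2.
  by rewrite PE !(expr2, m1, m0, cD, c01, c11, v0, v1, R1', q0) /=; ring.
have P2 : coefu 2 P = x * coefu 1 q *+ 2 + x ^+ 3 + x ^+ 4 *+ 6.
  rewrite PE (expr2 fu) -(mulrA fu) !cD /= !cu2 cu1 S0 R2' c21.
  by rewrite !(expr2, m1, q0); ring.
have px := polyin_x x; have p1 := polyin_1 x.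
have pe1 : polyin x e1.
  by rewrite e1_eq; apply: polyin_opp; apply: polyin_mul => //; exact: polyin_add.
have pe2 : polyin x (coefu 2 e).
  rewrite e2_eq; apply: polyin_mul => //; apply: polyin_add.
    by apply: polyin_add; apply: polyin_muln => //; exact: polyin_exp.
  by apply: polyin_opp; exact: polyin_exp.
have pq1 : polyin x (coefu 1 q).
  rewrite q1; apply: polyin_mul => //; apply: polyin_add; last exact: polyin_opp.
  exact: polyin_muln.
have pP1 : polyin x (coefu 1 P) by rewrite P1; exact: polyin_exp.
have pP2 : polyin x (coefu 2 P).
  rewrite P2; apply: polyin_add; last by apply: polyin_muln; exact: polyin_exp.
  by apply: polyin_add; [apply: polyin_muln; exact: polyin_mul | exact: polyin_exp].
have Me : M = embed C * ((1 + e) * P) by rewrite M_P Y_e mulrA.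
move=> i2; exists (coefu i ((1 + e) * P)); last by rewrite Me coefu_embedM.
case: i i2 => [|[|[|]]] // _.
- by rewrite m0 P0 mulr1 cD /= e0 c01 addr0.
- rewrite m1 !cD /= e0 c01 c11 P0; apply: polyin_add; apply: polyin_mul => //.
    by rewrite addr0.
  by rewrite add0r.
- rewrite m2 !cD /= e0 c01 c11 c21 P0; apply: polyin_add; first apply: polyin_add.
  + by rewrite addr0 mul1r.
  + by rewrite add0r; exact: polyin_mul.
  + by rewrite add0r mulr1.
Qed.
End Tree.

(** * The Catalan series, and the reduction of the theorem to the functional equation *)

Lemma natr_neq0 (n : nat) : n.+1%:R != 0 :> rat.
Proof. by rewrite pnatr_eq0. Qed.

Lemma central_binS n :
  'C(n.+1.*2, n.+1)%:R = 2 * (2 * n%:R + 1) / (n%:R + 1) * 'C(n.*2, n)%:R :> rat.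
Proof.
have H : (n.+1 * 'C(n.+1.*2, n.+1) = 2 * (2 * n + 1) * 'C(n.*2, n))%N.
  have e1 := mul_bin_diag n.+1.*2 n; have e2 := mul_bin_down n.*2.+1 n.
  rewrite doubleS /= in e1 e2 *; rewrite -e1.
  have e3 : (n.*2.+1 - n = n.+1)%N by lia.
  rewrite e3 in e2; nia.
have /= := congr1 (fun k => k%:R : rat) H; rewrite !(natrM, natrD) => Hq.
have n0 : (n%:R + 1 : rat) != 0 by rewrite natr1 natr_neq0.
apply: (mulfI (_ : n.+1%:R != 0)); first exact: natr_neq0.
by rewrite Hq -natr1; field.
Qed.

Lemma Cps_rec n : \sum_(k < n.+1) Cps k * Cps (n - k)%N = Cps n.+1.
Proof.
pose b (k : nat) : rat := 'C(k.*2, k)%:R.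
(* Gosper's certificate for the Catalan convolution. *)
pose G (k : nat) := b k * b (n.+1 - k)%N * (2 * k%:R - n.+1%:R) / (2 * n.+1%:R * n.+2%:R).
have step (k : 'I_n.+1) : Cps k * Cps (n - k)%N = G k.+1 - G k.
  have kn : (k <= n)%N by rewrite -ltnS.
  rewrite /G /Cps -!/(b _) subSS subSn //.
  have -> : n.+1%:R = k%:R + (n - k)%:R + 1 :> rat by rewrite -natrD subnKC // natr1.
  have -> : n.+2%:R = k%:R + (n - k)%:R + 2 :> rat by rewrite -natrD subnKC // -addn2 natrD.
  rewrite /b !central_binS -!/(b _) -[k.+1%:R]natr1 -[(n - k).+1%:R]natr1.
  have h1 : k%:R + 1 != 0 :> rat by rewrite natr1 natr_neq0.
  have h2 : (n - k)%:R + 1 != 0 :> rat by rewrite natr1 natr_neq0.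
  have h3 : k%:R + (n - k)%:R + 1 != 0 :> rat by rewrite -natrD natr1 natr_neq0.
  have h4 : k%:R + (n - k)%:R + 2 != 0 :> rat by rewrite -!natrD addn2 natr_neq0.
  by field; rewrite h1 h2 h3 h4.
under eq_bigr do rewrite step.
rewrite -(big_mkord xpredT (fun k => G k.+1 - G k)) telescope_sumr // /G subnn subn0.
rewrite /Cps -!/(b _) [b 0%N]/b bin0 mul1r mulr1 mulr0.
by field; rewrite nat1r -natrD !natr_neq0.
Qed.

Definition catalan : qz := Fps Cps.

Lemma catalan_eq : catalan = 1 + fX * catalan ^+ 2.
Proof.
apply: fpsP => -[|n]; rewrite fcoefD fcoefXM fcoef1 /=.
  by rewrite /Cps bin0 addr0 divr1.
by rewrite add0r -Cps_rec.
Qed.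

Definition zcat2 : qz := Fps zC2.

Lemma zcat2_eq : zcat2 = fX * catalan ^+ 2.
Proof. by apply: fpsP => n. Qed.

Lemma psexp_fps (f : qz) k n : psexp f k n = (f ^+ k) n.
Proof.
elim: k n => [|k IH] n //; rewrite exprS fcoefM /psexp iterS -/(psexp f k) /psmul.
by apply: eq_bigr => i _; rewrite IH.
Qed.

Lemma pscomp_fps Q (f : qz) n : pscomp Q f n = (map_poly fC Q).[f] n.
Proof.
rewrite (@horner_coef_wide _ (size Q)) ?size_poly // fcoef_sum.
by apply: eq_bigr => i _; rewrite coef_map [RHS]fcoefCM psexp_fps.
Qed.

Lemma theorem4_of_gf (M Y : qzu) (z' := embed fX * (1 - fu)) (q := z' * Y ^+ 2) :
  (1 - z' * M) * Y = 1 ->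
  (forall N, exists L (a : nat -> {poly rat}) (R : qzu),
    (forall j, (j <= N)%N -> coefu j R = 0) /\
    M = Y * (1 + fu * q ^+ 2 + fu ^+ 2 * (q ^+ 3 + q ^+ 4 *+ 6
             + fu * \sum_(l < L) fC (a l) * q ^+ l) + R)) ->
  (forall i n, Vhat i n = (M n)`_i) ->
  (forall i : nat, (i <= 2)%N ->
     exists Q : {poly rat},
       forall n : nat, Vhat i n = psmul Cps (pscomp Q zC2) n) /\
  (forall i : nat, (3 <= i)%N ->
     exists Q : {poly rat},
       forall n : nat,
         psmul (psexp (pssub ps1 zC2) (2 * i - 3)) (Vhat i) n
         = psmul Cps (pscomp Q zC2) n).
Proof.
move=> YM ME VM.
have CE : catalan = 1 + zcat2 by rewrite zcat2_eq -catalan_eq.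
have VE i n : Vhat i n = coefu i M n by rewrite VM.
split=> i i_bound.
  have [g [Q gQ] eg] := coefuM_regular YM zcat2_eq CE ME i_bound.
  exists Q => n; rewrite VE eg fcoefM.
  by apply: eq_bigr => k _; rewrite gQ (pscomp_fps _ zcat2).
have [g [Q gQ] eg] := coefuM_pole YM zcat2_eq CE ME i.
(* The pole has order at most [i], so the numerator absorbs the surplus (2i - 3) - i = i - 3. *)
have [Q' Q'E] : polyin zcat2 ((1 - zcat2) ^+ (i - 3) * g).
  apply: polyin_mul; last by exists Q.
  by apply: polyin_exp; apply: polyin_add (polyin_1 _) (polyin_opp (polyin_x _)).
exists Q' => n.
transitivity (((1 - zcat2) ^+ (2 * i - 3) * coefu i M) n).
  rewrite fcoefM; apply: eq_bigr => k _; rewrite VE -psexp_fps; congr (_ * _).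
have -> : (2 * i - 3 = (i - 3) + i)%N by lia.
rewrite exprD -mulrA eg mulrCA Q'E fcoefM.
by apply: eq_bigr => k _; rewrite (pscomp_fps _ zcat2).
Qed.

(** * Generating functions of tree words *)

Lemma sum_triangle (V : zmodType) (G : nat -> nat -> V) N :
  \sum_(m < N) \sum_(j < m.+1) G j (m - j)%N = \sum_(j < N) \sum_(k < N - j) G j k.
Proof.
elim: N => [|N IH]; first by rewrite !big_ord0.
rewrite big_ord_recr IH /= [RHS]big_ord_recr /= subSnn big_ord1 big_ord_recr /= subnn addrA.
congr (_ + _); rewrite -big_split; apply: eq_bigr => j _ /=.
by rewrite subSn ?big_ord_recr //= ltnW.
Qed.

Lemma sum_truncate (V : zmodType) (F : nat -> V) n m : (n <= m)%N ->
  (forall k, (n <= k)%N -> F k = 0) -> \sum_(k < m) F k = \sum_(k < n) F k.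
Proof.
move=> nm F0; rewrite -!(big_mkord xpredT F) (@big_cat_nat _ _ _ n) //= [X in _ + X]big_nat_cond.
by rewrite [X in _ + X]big1 ?addr0 // => k /andP[/andP[nk _] _]; exact: F0.
Qed.

Lemma sum_odd_terms (V : zmodType) (F : nat -> V) l : (forall a, F (2 * a)%N = 0) ->
  \sum_(k < (2 * l).+1) F k = \sum_(a < l) F (2 * a).+1.
Proof.
move=> F0; elim: l => [|l IH]; first by rewrite big_ord1 big_ord0 (F0 0%N).
have -> : (2 * l.+1 = (2 * l).+2)%N by lia.
rewrite big_ord_recr big_ord_recr /= IH big_ord_recr /=.
have -> : ((2 * l).+2 = 2 * l.+1)%N by lia.
by rewrite F0 addr0.
Qed.

Section Series.
Implicit Types f g : nat -> nat -> nat.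

Definition egf f m n : rat := (f m n)%:R / (m`!)%:R.

(* The coefficient of z^l, the power of u being the excess l + 1 - m. *)
Definition lvl f l : {poly rat} := \sum_(m < l.+2) egf f m (2 * l).+1 *: 'X^(l.+1 - m).

(* Includes the substitution of z (1 - u) for z. *)
Definition ser f : qzu := Fps (fun l => (1 - 'X) ^+ l * lvl f l).

Definition tree_supp f := forall m n, ~~ [&& (0 < m)%N, odd n & (m.-1.*2 <= n.-1)%N] -> f m n = 0%N.

(** Letters are distributed by a binomial choice, while sizes add up to [n.-1]: the letter carrying
    the insertion is repeated. *)
Definition bconv f g m n : nat :=
  (\sum_(j < m.+1) 'C(m, j) * \sum_(k < n) f j k * g (m - j) (n.-1 - k))%N.

Lemma egf_eq0 f m a : tree_supp f -> (a.+1 < m)%N -> egf f m (2 * a).+1 = 0.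
Proof.
move=> sf am; rewrite /egf sf ?mul0r //; apply/negP => /and3P[_ _] /=; lia.
Qed.

Lemma egf_bconv f g m l : tree_supp f -> tree_supp g ->
  egf (bconv f g) m (2 * l).+1 =
  \sum_(a < l) \sum_(j < m.+1) egf f j (2 * a).+1 * egf g (m - j) (2 * (l.-1 - a)).+1.
Proof.
move=> sf sg; rewrite /egf /bconv natr_sum mulr_suml exchange_big /=.
apply: eq_bigr => j _; have jm : (j <= m)%N by rewrite -ltnS.
rewrite natrM natr_sum.
under eq_bigr do rewrite natrM.
rewrite (sum_odd_terms (F := fun k => (f j k)%:R * (g (m - j)%N (2 * l - k)%N)%:R)); last first.
  by move=> a; rewrite sf ?mul0r // oddM /= andbF.
rewrite mulrAC mulr_sumr; apply: eq_bigr => a _.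
have -> : (2 * l - (2 * a).+1 = (2 * (l.-1 - a)).+1)%N by have := ltn_ord a; lia.
have -> : ('C(m, j))%:R / (m`!)%:R = ((j`!)%:R^-1 * ((m - j)`!)%:R^-1 : rat).
  rewrite -(bin_fact jm) !natrM; have := fact_gt0 j; have := fact_gt0 (m - j).
  have := bin_gt0 m j; rewrite jm => b0 f1 f2.
  by field; rewrite !pnatr_eq0 -!lt0n b0 f1 f2.
by ring.
Qed.

(** An insertion adds one edge, crossed once each way: half-lengths add up to [l.-1], letters add up
    to [m], and so the excess is additive. *)
Lemma lvl_bconv f g l : tree_supp f -> tree_supp g ->
  lvl (bconv f g) l = \sum_(a < l) lvl f a * lvl g (l.-1 - a).
Proof.
move=> sf sg; rewrite /lvl.
under eq_bigr do rewrite egf_bconv // scaler_suml.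
rewrite exchange_big /=; apply: eq_bigr => a _; have al := ltn_ord a.
set b := (l.-1 - a)%N.
pose G j k : {poly rat} :=
  (egf f j (2 * a).+1 * egf g k (2 * b).+1) *: 'X^(l.+1 - (j + k)).
transitivity (\sum_(m < l.+2) \sum_(j < m.+1) G j (m - j)%N).
  apply: eq_bigr => m _; rewrite scaler_suml; apply: eq_bigr => j _.
  by rewrite /G subnKC // -ltnS.
rewrite sum_triangle (@sum_truncate _ (fun j => \sum_(k < l.+2 - j) G j k) a.+2); first last.
- move=> j aj; apply: big1 => k _; by rewrite /G egf_eq0 // mul0r scale0r.
- by lia.
rewrite big_distrlr /=; apply: eq_bigr => j _; have ja := ltn_ord j.
rewrite (@sum_truncate _ (G j) b.+2); first last.
- move=> k bk; by rewrite /G [egf g _ _]egf_eq0 // mulr0 scale0r.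
- by rewrite /b; lia.
apply: eq_bigr => k _; have kb := ltn_ord k.
rewrite /G -scalerAl -scalerAr scalerA -exprD; congr (_ *: 'X^_).
by move: kb; rewrite /b; lia.
Qed.
End Series.

(** * The recursion over the marked position *)

Definition zu : qzu := embed fX * (1 - fu).

Lemma zuE : zu = fX * fC (1 - 'X).
Proof.
rewrite /zu rmorphB rmorph1; congr (_ * _).
by apply: fpsP => n /=; case: (n == 1%N); rewrite ?polyC1 ?polyC0.
Qed.

Lemma ser_bconv f g : tree_supp f -> tree_supp g -> ser (bconv f g) = zu * (ser f * ser g).
Proof.
move=> sf sg; apply: fpsP => l; rewrite zuE -mulrA fcoefXM [LHS]/= lvl_bconv //.
case: l => [|l]; first by rewrite big_ord0 mulr0.
rewrite fcoefCM fcoefM exprS -mulrA mulr_sumr; congr (_ * _); apply: eq_bigr => a _ /=.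
by rewrite -{1}(subnKC (leq_ord a)) exprD mulrACA.
Qed.

Definition open_series i : qzu := ser (cntH i).
Definition tree_series : qzu := ser cntT.
Definition rho l : {poly rat} := lvl cntR l.

Lemma open_series0 : open_series 0 = tree_series.
Proof.
apply: fpsP => l /=; congr (_ * _); apply: eq_bigr => m _.
by rewrite /egf cntH0.
Qed.

Lemma open_series_rec i : open_series i = open_series i.+1 +
  Fps (fun n => if (2 * n == i)%N then (1 - 'X) ^+ n * rho n else 0) + zu * (open_series i * tree_series).
Proof.
have sH : tree_supp (cntH i) by move=> m n; exact: cntH_eq0.
have sT : tree_supp cntT by move=> m n; exact: cntT_eq0.
rewrite -ser_bconv //; apply: fpsP => l; rewrite !fcoefD /=.
transitivity ((1 - 'X) ^+ l *
  (lvl (cntH i.+1) l + (if (2 * l == i)%N then rho l else 0) + lvl (bconv (cntH i) cntT) l)).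
  congr (_ * _); transitivity (\sum_(m < l.+2) (egf (cntH i.+1) m (2 * l).+1 +
    (if (2 * l == i)%N then egf cntR m (2 * l).+1 else 0) +
    egf (bconv (cntH i) cntT) m (2 * l).+1) *: 'X^(l.+1 - m) : {poly rat}).
    apply: eq_bigr => m _; congr (_ *: _); rewrite {1}/egf cntH_rec !natrD !mulrDl; congr (_ + _ + _).
    by case: eqP => _; rewrite ?mul1n ?mul0n ?mul0r.
  under eq_bigr do rewrite !scalerDl.
  rewrite !big_split; congr (_ + _ + _); case: eqP => // _.
  by rewrite big1 // => m _; rewrite scale0r.
by rewrite !mulrDr; case: eqP => _; rewrite ?mulr0.
Qed.

Definition inv_series : qzu := finv1 (zu * tree_series).

Lemma zu_tree_series0 : (zu * tree_series) 0%N = 0.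
Proof. by rewrite zuE -mulrA fcoefXM. Qed.

Lemma inv_seriesK : (1 - zu * tree_series) * inv_series = 1.
Proof. exact/finv1P/zu_tree_series0. Qed.

Lemma open_series_step i : open_series i = inv_series * (open_series i.+1 +
  Fps (fun n => if (2 * n == i)%N then (1 - 'X) ^+ n * rho n else 0)).
Proof.
set E := Fps _.
have <- : open_series i * (1 - zu * tree_series) = open_series i.+1 + E by rewrite mulrBr mulr1 {1}open_series_rec -/E; ring.
by rewrite mulrC -mulrA inv_seriesK mulr1.
Qed.

Definition q : qzu := zu * inv_series ^+ 2.

(** Each position passed by the mark contributes a factor [inv_series]. Reduced words end only at
    even marks [2 * l], after 2l + 1 positions, and the last summand holds the words whose mark is
    still moving. *)
Lemma tree_series_expand N : tree_series = inv_series * (\sum_(l < N) fC (rho l) * q ^+ l) + inv_series ^+ (2 * N) * open_series (2 * N).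
Proof.
elim: N => [|N IH]; first by rewrite big_ord0 mulr0 muln0 expr0 mul1r add0r open_series0.
rewrite {1}IH big_ord_recr /= open_series_step open_series_step.
have -> : Fps (fun n => if (2 * n == (2 * N).+1)%N then (1 - 'X) ^+ n * rho n else 0) = 0.
  by apply: fpsP => n /=; case: eqP => // /(congr1 odd) /=; rewrite !oddM.
have -> : Fps (fun n => if (2 * n == 2 * N)%N then (1 - 'X) ^+ n * rho n else 0) =
    fC (rho N) * zu ^+ N.
  apply: fpsP => n; rewrite zuE exprMn [fX ^+ _ * _]mulrC -rmorphXn !fcoefCM fcoefXn /=.
  rewrite eqn_mul2l /=; case: eqP => [->|_]; last by rewrite !mulr0.
  by rewrite mulr1 mulrC.
have -> : (2 * N.+1 = (2 * N).+2)%N by lia.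
have -> : q ^+ N = zu ^+ N * inv_series ^+ (2 * N) by rewrite /q exprMn -exprM.
by rewrite addr0 !exprS; ring.
Qed.

Lemma rho_coef l k : (rho l)`_k = if (k <= l.+1)%N then egf cntR (l.+1 - k) (2 * l).+1 else 0.
Proof.
rewrite /rho /lvl coef_sum; under eq_bigr do rewrite coefZ coefXn.
case: leqP => kl.
  have kl2 : (l.+1 - k < l.+2)%N by rewrite ltnS leq_subr.
  rewrite (bigD1 (Ordinal kl2)) //= subKn // eqxx mulr1 big1 ?addr0 // => m mk.
  case: eqP => [kE|]; rewrite ?mulr0 //; case/eqP: mk; apply/val_inj => /=.
  by have := ltn_ord m; lia.
rewrite big1 // => m _; case: eqP => [kE|]; rewrite ?mulr0 //.
by move: kl; rewrite kE ltnNge leq_subr.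
Qed.

Lemma rho_coef_small l k : (2 * k < l)%N -> (rho l)`_k = 0.
Proof.
move=> kl; rewrite rho_coef ifT; last by lia.
by rewrite /egf cntR_eq0 ?mul0r //=; lia.
Qed.

Lemma cntR_tree m n : ~~ [&& (0 < m)%N, odd n & (m.-1.*2 <= n.-1)%N] -> cntR m n = 0%N.
Proof. by move/cntT_eq0/cntR_T. Qed.

Lemma rho_take l : take_poly 3 (rho l) =
  (l == 0%N)%:R + (l == 2%N)%:R * 'X + (l == 3%N)%:R * 'X^2 + (l == 4%N)%:R * ('X^2 *+ 6).
Proof.
apply/polyP => k; rewrite coef_take_poly.
rewrite !coefD !mulr_natl !coefMn coef1 coefX !coefXn.
case: ltnP => k3; last first.
  case: k k3 => [|[|[|k]]] //= _.
  by case: (l == 0%N); case: (l == 2%N); case: (l == 3%N); case: (l == 4%N).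
have [lk|lk] := ltnP (2 * k) l.
  (* Beyond half-length [2 * k] nothing survives, so only [l <= 4] remains to be inspected. *)
  by rewrite rho_coef_small //; case: k k3 lk => [|[|[|]]] // _; case: l => [|[|[|[|[|]]]]].
rewrite rho_coef /egf; case: k k3 lk => [|[|[|]]] // _ lk.
- by case: l lk => // _; rewrite cntR_1_1 /=.
- case: l lk => [|[|[|]]] // _; rewrite /=.
  + by rewrite cntR_tree.
  + by rewrite cntR_T ?cntT_1.
  + by rewrite cntR_2_5.
- case: l lk => [|[|[|[|[|]]]]] // _; rewrite /=.
  + by rewrite cntR_tree.
  + by rewrite cntR_T ?cntT_1.
  + by rewrite cntR_2_7.
  + by rewrite cntR_3_9.
Qed.

Lemma rho_split l : fC (rho l) = (l == 0%N)%:R + (l == 2%N)%:R * fu + (l == 3%N)%:R * fu ^+ 2 +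
  (l == 4%N)%:R * (fu ^+ 2 *+ 6) + fu ^+ 3 * fC (drop_poly 3 (rho l)).
Proof.
rewrite -{1}(poly_take_drop 3 (rho l)) rho_take /fu.
by rewrite !(rmorphD, rmorphM, rmorph_nat, rmorphMn, rmorphXn) /= [fu ^+ 3 * _]mulrC.
Qed.

Lemma tree_series_eq N : exists L (a : nat -> {poly rat}) (R : qzu),
  (forall j, (j <= N)%N -> coefu j R = 0) /\
  tree_series = inv_series * (1 + fu * q ^+ 2 + fu ^+ 2 * (q ^+ 3 + q ^+ 4 *+ 6
           + fu * \sum_(l < L) fC (a l) * q ^+ l) + R).
Proof.
(* More than [2 * N] terms exhaust the orders of u up to [N]; five ensure that the explicit terms
   [l <= 4] are present. *)
pose L := (2 * N + 5)%N.
pose P := (1 - zu * tree_series) * tree_series.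
exists L, (fun l => drop_poly 3 (rho l)), (P - \sum_(l < L) fC (rho l) * q ^+ l); split.
  move=> j jN; apply: fpsP => n.
  (* The expansion is taken longer than [n], so that its leftover [open_series] starts beyond
     z^n. *)
  have -> : P = \sum_(l < n.+1 + L) fC (rho l) * q ^+ l +
      (1 - zu * tree_series) * inv_series ^+ (2 * (n.+1 + L)) * open_series (2 * (n.+1 + L)).
    by rewrite /P {2}(tree_series_expand (n.+1 + L)) mulrDr !mulrA inv_seriesK mul1r.
  have small f K : (n < K)%N -> (f * open_series (2 * K)) n = 0.
    move=> nK; rewrite fcoefM big1 // => i _ /=; rewrite /lvl big1 ?mulr0 // => m _.
    rewrite /egf cntH_small ?mul0r ?scale0r //; have := leq_subr i n; lia.
  have cD (f g : qzu) : coefu j (f + g) n = coefu j f n + (g n)`_j by rewrite raddfD.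
  rewrite addrAC cD small ?coef0 ?addr0; last by lia.
  have -> : \sum_(l < n.+1 + L) fC (rho l) * q ^+ l - \sum_(l < L) fC (rho l) * q ^+ l =
      \sum_(k < n.+1) fC (rho (L + k)) * q ^+ (L + k).
    by rewrite addnC big_split_ord /= addrAC subrr add0r.
  rewrite raddf_sum fcoef_sum big1 // => k _.
  transitivity (coefu j (fC (rho (L + k)) * q ^+ (L + k)) n) => //.
  rewrite coefuM fcoef_sum big1 // => i _; rewrite coefu_fC rho_coef_small ?rmorph0 ?mul0r //.
  by have := ltn_ord i; rewrite /L; lia.
have YP : tree_series = inv_series * P by rewrite /P mulrA [inv_series * _]mulrC inv_seriesK mul1r.
rewrite {1}YP; congr (inv_series * _); rewrite -[LHS](subrK (\sum_(l < L) fC (rho l) * q ^+ l)) [LHS]addrC.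
congr (_ + _); under eq_bigr do rewrite rho_split !mulrDl.
rewrite !big_split /= /L.
have pick k (c : qzu) : (k < L)%N -> \sum_(l < L) (l == k :> nat)%:R * c * q ^+ l = c * q ^+ k.
  move=> kL; rewrite (bigD1 (Ordinal kL)) //= eqxx mul1r big1 ?addr0 // => i ik.
  by rewrite (_ : (i == k :> nat) = false) ?mul0r //; apply: contraNF ik => /eqP iE; apply/eqP/val_inj.
have pick0 : \sum_(l < L) (l == 0 :> nat)%:R * q ^+ l = 1.
  rewrite -[RHS](mulr1 1) -(expr0 q) -(pick 0%N 1) //; last by rewrite /L; lia.
  by apply: eq_bigr => i _; rewrite mulr1.
rewrite pick0 !pick; try by rewrite /L; lia.
under [X in _ + X = _]eq_bigr do rewrite -mulrA.
by rewrite -mulr_sumr -/L; ring.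
Qed.

Lemma coef_one_subX l j : ((1 - 'X : {poly rat}) ^+ l)`_j = (-1) ^+ j * ('C(l, j))%:R.
Proof.
have -> : (1 - 'X : {poly rat}) = (-1)%:P * 'X + 1 by rewrite polyCN mulN1r addrC.
rewrite exprD1n coef_sum.
under eq_bigr do rewrite coefMn exprMn -rmorphXn coefCM coefXn.
have [jl|jl] := ltnP j l.+1.
  rewrite (bigD1 (Ordinal jl)) //= eqxx mulr1 mulr_natr big1 ?addr0 // => i ij.
  by rewrite (_ : (j == i :> nat) = false) ?mulr0 ?mul0rn //; apply: contraNF ij => /eqP jE; apply/eqP/val_inj.
rewrite bin_small // mulr0 big1 // => i _.
rewrite (_ : (j == i :> nat) = false) ?mulr0 ?mul0rn //.
by apply/eqP => jE; move: jl; rewrite jE leqNgt ltn_ord.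
Qed.

Lemma Vhat_coef i n : Vhat i n = (tree_series n)`_i.
Proof.
rewrite /= mulrC coefM /Vhat; apply: eq_bigr => k _; rewrite coef_one_subX; congr (_ * _).
rewrite -/(lvl cntT n) /lvl coef_sum /wcoef; under eq_bigr do rewrite coefZ coefXn.
case: leqP => kl.
  have kl2 : (n.+1 - k < n.+2)%N by rewrite ltnS leq_subr.
  rewrite (bigD1 (Ordinal kl2)) //= subKn // eqxx mulr1 big1 ?addr0 ?/egf ?w_cntT // => m mk.
  case: eqP => [kE|]; rewrite ?mulr0 //; case/eqP: mk; apply/val_inj => /=.
  by have := ltn_ord m; lia.
rewrite big1 // => m _; case: eqP => [kE|]; rewrite ?mulr0 //.
by move: kl; rewrite kE ltnNge leq_subr.
Qed.

Theorem theorem4 :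
  (forall i : nat, (i <= 2)%N ->
     exists Q : {poly rat},
       forall n : nat, Vhat i n = psmul Cps (pscomp Q zC2) n) /\
  (forall i : nat, (3 <= i)%N ->
     exists Q : {poly rat},
       forall n : nat,
         psmul (psexp (pssub ps1 zC2) (2 * i - 3)) (Vhat i) n
         = psmul Cps (pscomp Q zC2) n).
Proof. exact: (theorem4_of_gf inv_seriesK tree_series_eq Vhat_coef). Qed.
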